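(* Let $\Sigma \subset \mathbb{R}^d$ be a bounded, smooth $k$-manifold without boundary for any $k$ with $1 \le k < d$. Consider two points $p, q \in \Sigma$ and let $\delta = |pq| / \mathrm{lfs}(p)$. If $\delta < \sqrt{(\sqrt{5}-1)/2}$ $(\approx 0.7861)$, then $\angle(N_p\Sigma, N_q\Sigma) = \angle(T_p\Sigma, T_q\Sigma) \leq \eta_2(\delta)$ where $$\eta_2(\delta) = \arccos\sqrt{1 - \frac{\delta^2}{\sqrt{1-\delta^2}}} = \delta + \frac{5}{12}\delta^3 + \frac{57}{160}\delta^5 + \frac{327}{896}\delta^7 + O(\delta^9) \quad (\delta \to 0).$$ Moreover, if $\delta_N$ is the distance from $q$ to the tangent space $T_p\Sigma$ divided by $\mathrm{lfs}(p)$, we have the (stronger) bound $$\angle(N_p\Sigma, N_q\Sigma) \leq \arccos\sqrt{\left( 1 - \frac{\delta^2}{2\sqrt{1-\delta^2}} \right)^2 - \frac{\delta_N^2}{1-\delta^2}}.$$ In the special case where $q \in T_p\Sigma$ (that is, $\delta_N = 0$), this bound reduces to $\eta_1(\delta) = \arccos\left( 1 - \frac{\delta^2}{2\sqrt{1-\delta^2}} \right)$.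
   Context: A bounded smooth manifold without boundary in $\mathbb{R}^d$ means a compact smoothly embedded submanifold without boundary. For $p \in \Sigma$, $T_p\Sigma$ is the tangent $k$-flat at $p$ and $N_p\Sigma$ is the $(d-k)$-flat through $p$ orthogonal to $T_p\Sigma$. The medial axis $M$ of $\Sigma$ is the closure of the set of points of $\mathbb{R}^d$ having more than one nearest point on $\Sigma$; the local feature size is $\mathrm{lfs}(p) = \min_{m \in M}|pm|$. For flats $F, G$ with $\dim F \le \dim G$, $\angle(F,G) = \angle(G,F) = \max_{\ell_F \subset F}\min_{\ell_G \subset G}\angle(\ell_F,\ell_G) \in [0^\circ,90^\circ]$, where $\ell_F,\ell_G$ range over lines and $\angle(\ell_F,\ell_G)$ is the nonobtuse angle between their directions. *)

(* Defs.v *)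
From HB Require Import structures.
From mathcomp Require Import all_boot all_order all_algebra.
From mathcomp Require Import all_classical all_reals all_analysis.
Import Order.TTheory GRing.Theory Num.Theory.
Import numFieldNormedType.Exports.

Set Implicit Arguments.
Unset Strict Implicit.
Unset Printing Implicit Defensive.

Local Open Scope classical_set_scope.
Local Open Scope ring_scope.

(* The library's norm on 'rV[R]_d is the sup norm, which induces the usual
   topology and differential calculus; the metric notions below use the
   Euclidean norm instead. *)
Definition dot (R : realType) (d : nat) (u v : 'rV[R]_d) : R :=
  \sum_(i < d) u 0 i * v 0 i.

Definition enorm (R : realType) (d : nat) (u : 'rV[R]_d) : R :=
  Num.sqrt (dot u u).

Definition dist (R : realType) (d : nat) (x y : 'rV[R]_d) : R := enorm (x - y).

(* The infimum is attained for the closed nonempty sets to which this is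
   applied. *)
Definition dist_set (R : realType) (d : nat) (x : 'rV[R]_d)
    (A : set 'rV[R]_d) : R :=
  inf [set dist x a | a in A].

(* [Ck_on n U f]: f is of class C^n on U; only used for open U and
   finite-dimensional V. *)
Fixpoint Ck_on (R : realType) (V W : normedModType R) (n : nat)
    (U : set V) (f : V -> W) : Prop :=
  match n with
  | 0 => forall x, U x -> {for x, continuous f}
  | n'.+1 => (forall x, U x -> differentiable f x) /\
             (forall v : V, Ck_on n' U (fun x => 'D_v f x))
  end.

Definition smooth_on (R : realType) (V W : normedModType R)
    (U : set V) (f : V -> W) : Prop :=
  forall n, Ck_on n U f.

(* R^k x {0} in R^d *)
Definition slice (R : realType) (d k : nat) : set 'rV[R]_d :=
  [set y | forall i : 'I_d, (k <= i)%N -> y 0 i = 0].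

(* [phi] is a smooth diffeomorphism from the open set [U] onto the open set
   [V], with inverse [psi], that straightens [S]. *)
Definition slice_chart (R : realType) (d k : nat) (S U V : set 'rV[R]_d)
    (phi psi : 'rV[R]_d -> 'rV[R]_d) : Prop :=
  [/\ open U /\ open V,
      smooth_on U phi /\ smooth_on V psi,
      (forall x, U x -> V (phi x) /\ psi (phi x) = x),
      (forall y, V y -> U (psi y) /\ phi (psi y) = y) &
      (forall x, U x -> (S x <-> slice k (phi x)))].

Definition smooth_submanifold (R : realType) (d k : nat)
    (S : set 'rV[R]_d) : Prop :=
  forall p, S p ->
    exists (U V : set 'rV[R]_d) (phi psi : 'rV[R]_d -> 'rV[R]_d),
      U p /\ slice_chart k S U V phi psi.

(* Velocities at p of smooth curves in S *)
Definition tangent_vector (R : realType) (d : nat) (S : set 'rV[R]_d)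
    (p v : 'rV[R]_d) : Prop :=
  exists (e : R) (c : R^o -> 'rV[R]_d),
    [/\ 0 < e, smooth_on [set t : R^o | - e < t < e] c,
        (forall t : R, - e < t < e -> S (c t)), c 0 = p &
        'D_(1 : R^o) c 0 = v].

Definition tangent_flat (R : realType) (d : nat) (S : set 'rV[R]_d)
    (p : 'rV[R]_d) : set 'rV[R]_d :=
  [set p + v | v in tangent_vector S p].

Definition normal_flat (R : realType) (d : nat) (S : set 'rV[R]_d)
    (p : 'rV[R]_d) : set 'rV[R]_d :=
  [set x | forall y, tangent_flat S p y -> dot (y - p) (x - p) = 0].

Definition nearest_point (R : realType) (d : nat) (S : set 'rV[R]_d)
    (x a : 'rV[R]_d) : Prop :=
  S a /\ forall b, S b -> dist x a <= dist x b.

Definition medial_axis (R : realType) (d : nat) (S : set 'rV[R]_d) :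
    set 'rV[R]_d :=
  closure [set x | exists a b,
    [/\ nearest_point S x a, nearest_point S x b & a <> b]].

Definition lfs (R : realType) (d : nat) (S : set 'rV[R]_d)
    (p : 'rV[R]_d) : R :=
  dist_set p (medial_axis S).

Definition line (R : realType) (d : nat) (a u : 'rV[R]_d) : set 'rV[R]_d :=
  [set a + t *: u | t in [set: R]].

(* Nonobtuse angle between the lines with nonzero direction vectors u, v *)
Definition line_angle (R : realType) (d : nat) (u v : 'rV[R]_d) : R :=
  acos (`|dot u v| / (enorm u * enorm v)).

(* The angle between flats F, G with dim F <= dim G, the maximum over the lines
   of F of the minimum over the lines of G. For flats containing lines these
   extrema are attained, hence equal to the sup and inf below. *)
Definition flat_angle (R : realType) (d : nat) (F G : set 'rV[R]_d) : R :=
  sup [set alpha | exists a u, [/\ u != 0, line a u `<=` F &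
    alpha = inf [set beta | exists b v, [/\ v != 0, line b v `<=` G &
      beta = line_angle u v]]]].

Definition eta1 (R : realType) (delta : R) : R :=
  acos (1 - delta ^+ 2 / (2 * Num.sqrt (1 - delta ^+ 2))).

Definition eta2 (R : realType) (delta : R) : R :=
  acos (Num.sqrt (1 - delta ^+ 2 / Num.sqrt (1 - delta ^+ 2))).

Definition eta_normal (R : realType) (delta deltaN : R) : R :=
  acos (Num.sqrt ((1 - delta ^+ 2 / (2 * Num.sqrt (1 - delta ^+ 2))) ^+ 2
                  - deltaN ^+ 2 / (1 - delta ^+ 2))).

(* Main.v *)
Require Import Defs.
From mathcomp Require Import all_boot all_order all_algebra.
From mathcomp Require Import all_classical all_reals all_analysis.
From mathcomp Require Import ring lra.
Import Order.TTheory GRing.Theory Num.Theory.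
Import numFieldNormedType.Exports.

(** Let p = 0, lfs p = 1 and let N, T denote normal and tangent parts at p. As
  long as a centre stays at distance at most 1 from p, the balls tangent to S
  at a point of S contain no point of S in their interior. For a unit vector c,
  following the curve of points b of S with b_T = l c_T from p up to
  l = 1 / sqrt (2 + 2 |c_N|) gives a point of S at distance at most
  sqrt (2 + 2 |c_N|) - 1 from c: the tangent ball at p forces |b_N| to be
  small. The curve does not stop earlier, because at a nearest point q where
  some tangent vector at p is normal to S at q, the tangent ball at q in that
  direction would contain such a b. Hence, if m is a unit normal at q and
  c = q + t m has norm 1, then 1 + t <= sqrt (2 + 2 |c_N|). Using both
  directions m and -m, with radii satisfying t t' = 1 - |q|^2, and
  Cauchy-Schwarz bounds |m_N| from below, which is the bound on the angle of
  the normal spaces. For the expansion, eta2 x is the arcsine of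
  x / (1 - x^2)^(1/4), and its derivative is an algebraic function of
  r = sqrt (1 - x^2) which is compared with the series at r = 1. *)

(** The value l = 1 / sqrt (2 + 2 |c_N|) comes from the worst case. Let n = - c_N / |c_N|, the
    centre of a unit ball tangent at p. The segment from n to c has length sqrt (2 + 2 |c_N|) and
    leaves that ball at a point with tangent part l c_T, at distance sqrt (2 + 2 |c_N|) - 1 from c.
    The obstacle is existence: the empty balls alone do not provide a point of S over l c_T. It can
    be reached as long as the tangent spaces met on the way project onto T_p. If this fails at q for
    a unit m in T_p normal at q, then c_N = q_N has length at most |q|^2 / 2, and the bound on t
    together with t^2 >= 1 - |q|^2 gives t <= |q|^2, hence |q|^4 + |q|^2 >= 1. This is the origin of
    the threshold sqrt ((sqrt 5 - 1) / 2). No curve is integrated: both the continuation along S and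
    the growth of empty balls come from maximising a penalised function on a compact set, which uses
    only first-order approximation of tangent vectors and uniqueness of nearest points. *)

Set Implicit Arguments.
Unset Strict Implicit.
Unset Printing Implicit Defensive.

Local Open Scope classical_set_scope.
Local Open Scope ring_scope.

(** * The Euclidean norm *)

Section Euclidean.
Context (R : realType) (d : nat).
Implicit Types (u v w x y : 'rV[R]_d) (a : R).

Lemma dotC u v : dot u v = dot v u.
Proof. by apply: eq_bigr => i _; rewrite mulrC. Qed.

Lemma dotDl u v w : dot (u + v) w = dot u w + dot v w.
Proof.
by rewrite /dot -big_split; apply: eq_bigr => i _; rewrite !mxE mulrDl.
Qed.

Lemma dotZl a u v : dot (a *: u) v = a * dot u v.
Proof.
by rewrite /dot mulr_sumr; apply: eq_bigr => i _; rewrite !mxE mulrA.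
Qed.

Lemma dotDr u v w : dot u (v + w) = dot u v + dot u w.
Proof. by rewrite dotC dotDl ![dot _ u]dotC. Qed.

Lemma dotZr a u v : dot u (a *: v) = a * dot u v.
Proof. by rewrite dotC dotZl dotC. Qed.

Lemma dotNl u v : dot (- u) v = - dot u v.
Proof. by rewrite -scaleN1r dotZl mulN1r. Qed.

Lemma dotNr u v : dot u (- v) = - dot u v.
Proof. by rewrite dotC dotNl dotC. Qed.

Lemma dot0l v : dot 0 v = 0.
Proof. by rewrite -(scale0r v) dotZl mul0r. Qed.

Lemma dot0r v : dot v 0 = 0.
Proof. by rewrite dotC dot0l. Qed.

Definition dotE := (dotDl, dotDr, dotNl, dotNr, dotZl, dotZr).

Lemma dot_ge0 u : 0 <= dot u u.
Proof. by apply: sumr_ge0 => i _; rewrite -expr2 sqr_ge0. Qed.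

Lemma dot_eq0 u : (dot u u == 0) = (u == 0).
Proof.
apply/eqP/eqP => [|->]; last by rewrite dot0l.
move=> /psumr_eq0P h; apply/rowP => i; rewrite mxE.
have /eqP := h (fun i _ => ltac:(by rewrite -expr2 sqr_ge0)) i isT.
by rewrite mulf_eq0 orbb => /eqP.
Qed.

Lemma enorm_ge0 u : 0 <= enorm u.
Proof. exact: sqrtr_ge0. Qed.

Lemma sqr_enorm u : enorm u ^+ 2 = dot u u.
Proof. by rewrite sqr_sqrtr ?dot_ge0. Qed.

Lemma enorm0 : enorm (0 : 'rV[R]_d) = 0.
Proof. by rewrite /enorm dot0l sqrtr0. Qed.

Lemma enorm_eq0 u : (enorm u == 0) = (u == 0).
Proof. by rewrite sqrtr_eq0 -dot_eq0 eq_le dot_ge0 andbT. Qed.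

Lemma enorm_gt0 u : (0 < enorm u) = (u != 0).
Proof. by rewrite lt_def enorm_ge0 andbT enorm_eq0. Qed.

Lemma enormZ a u : enorm (a *: u) = `|a| * enorm u.
Proof.
by rewrite /enorm dotZl dotZr mulrA -expr2 sqrtrM ?sqr_ge0// sqrtr_sqr.
Qed.

Lemma enormN u : enorm (- u) = enorm u.
Proof. by rewrite /enorm dotNl dotNr opprK. Qed.

Lemma enormB u v : enorm (u - v) = enorm (v - u).
Proof. by rewrite -enormN opprB. Qed.

Lemma enorm_le u a : 0 <= a -> (enorm u <= a) = (dot u u <= a ^+ 2).
Proof.
by move=> a0; rewrite -sqr_enorm ler_pXn2r// nnegrE enorm_ge0.
Qed.

Lemma enorm_ge u a : 0 <= a -> (a <= enorm u) = (a ^+ 2 <= dot u u).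
Proof.
by move=> a0; rewrite -sqr_enorm ler_pXn2r// nnegrE enorm_ge0.
Qed.

Lemma dot_le u v : dot u v <= enorm u * enorm v.
Proof.
have [->|u0] := eqVneq u 0; first by rewrite dot0l enorm0 mul0r.
have [->|v0] := eqVneq v 0; first by rewrite dot0r enorm0 mulr0.
have pu : 0 < enorm u by rewrite enorm_gt0.
have pv : 0 < enorm v by rewrite enorm_gt0.
have := dot_ge0 (enorm v *: u - enorm u *: v).
rewrite !dotE -!sqr_enorm (dotC v u) => h.
have {h} : 0 <= 2 * (enorm u * enorm v) * (enorm u * enorm v - dot u v).
  by move: h; congr (_ <= _); ring.
by rewrite pmulr_rge0 ?subr_ge0// !mulr_gt0.
Qed.

Lemma normr_dot_le u v : `|dot u v| <= enorm u * enorm v.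
Proof.
rewrite ler_norml dot_le andbT lerNl -dotNl.
by rewrite -(enormN u) dot_le.
Qed.

Lemma enormD u v : enorm (u + v) <= enorm u + enorm v.
Proof.
rewrite enorm_le ?addr_ge0 ?enorm_ge0// !dotE -!sqr_enorm (dotC v u).
by have := dot_le u v; lra.
Qed.

Lemma enorm_dist u v : enorm u - enorm v <= enorm (u - v).
Proof. by rewrite lerBlDr; have := enormD (u - v) v; rewrite subrK. Qed.

Lemma enorm_distN u v : `|enorm u - enorm v| <= enorm (u - v).
Proof.
rewrite ler_norml enorm_dist andbT lerNl opprB enormB.
exact: enorm_dist.
Qed.

Lemma enormD_triangle w u v : enorm (u - v) <= enorm (u - w) + enorm (w - v).
Proof. by rewrite -{1}(subrK w u) -addrA enormD. Qed.

Lemma dot_mulmx u v : dot u v = (u *m v^T) 0 0.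
Proof. by rewrite mxE; apply: eq_bigr => i _; rewrite mxE. Qed.

Lemma unit_vector u : u != 0 -> exists2 v, enorm v = 1 & u = enorm u *: v.
Proof.
rewrite -enorm_gt0 => u0; exists ((enorm u)^-1 *: u).
  by rewrite enormZ gtr0_norm ?invr_gt0// mulVf ?gt_eqF.
by rewrite scalerA divff ?scale1r// gt_eqF.
Qed.

Lemma coord_le_enorm u i : `|u 0 i| <= enorm u.
Proof.
rewrite -ler_sqr ?nnegrE ?enorm_ge0// sqr_enorm real_normK ?num_real//.
rewrite /dot (bigD1 i)//= -expr2 lerDl.
by apply: sumr_ge0 => j _; rewrite -expr2 sqr_ge0.
Qed.

Lemma normr_le_enorm u : `|u| <= enorm u.
Proof.
rewrite [leLHS]/Num.Def.normr/= mx_normrE (bigmax_le _ (enorm_ge0 u))//=.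
by move=> -[i j] _ /=; rewrite ord1 coord_le_enorm.
Qed.

Lemma coord_le_normr u i : `|u 0 i| <= `|u|.
Proof.
rewrite [leRHS]/Num.Def.normr/= mx_normrE.
by apply/bigmax_geP; right => /=; exists (0, i).
Qed.

(** The factor d + 1 instead of sqrt d avoids a root and can be divided by even when d = 0. *)
Lemma enorm_le_normr u : enorm u <= (d%:R + 1) * `|u|.
Proof.
have d0 : 0 <= d%:R :> R by [].
rewrite enorm_le ?mulr_ge0 ?addr_ge0// /dot.
apply: (@le_trans _ _ (\sum_(i < d) `|u| ^+ 2)).
  apply: ler_sum => i _; rewrite -expr2 -(real_normK (num_real (u 0 i))).
  by rewrite ler_sqr ?nnegrE// coord_le_normr.
rewrite sumr_const card_ord -[leLHS]mulr_natl exprMn.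
apply: ler_wpM2r; rewrite ?sqr_ge0//; nra.
Qed.

(** The topology comes from the sup norm; this equivalence of norms lets every later limit be
    handled with Euclidean balls. *)
Lemma nbhs_enormP x (A : set 'rV[R]_d) :
  nbhs x A <-> exists2 e, 0 < e & forall y, enorm (y - x) < e -> A y.
Proof.
split=> [/nbhs_ballP[e /= e0 sA]|[e e0 sA]].
  exists e => // y hy; apply: sA; rewrite -ball_normE /=.
  by rewrite -opprB normrN (le_lt_trans (normr_le_enorm _)).
have d0 : 0 < d%:R + 1 :> R by rewrite ltr_wpDl.
apply/nbhs_ballP; exists (e / (d%:R + 1)); first by rewrite /= divr_gt0.
move=> y; rewrite -ball_normE /= -opprB normrN => hy; apply: sA.
apply: (le_lt_trans (enorm_le_normr _)).
by rewrite mulrC -ltr_pdivlMr.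
Qed.

Lemma enorm_lipschitz_continuous (f : 'rV[R]_d -> R) C :
  (forall x y, `|f x - f y| <= C * enorm (x - y)) -> continuous f.
Proof.
move=> hf x; apply/(@cvgrPdist_lt R R^o _ (nbhs x)) => e e0.
have C0 : 0 < `|C| + 1 by rewrite ltr_wpDl.
apply/nbhs_enormP; exists (e / (`|C| + 1)); first by rewrite divr_gt0.
move=> y; rewrite ltr_pdivlMr// mulrC => hy.
apply: le_lt_trans (hf _ _) (le_lt_trans _ hy); rewrite enormB.
by rewrite ler_wpM2r ?enorm_ge0// ler_wpDr// ler_norm.
Qed.

Lemma continuous_dotr v : continuous (fun u => dot u v).
Proof.
apply: (@enorm_lipschitz_continuous _ (enorm v)) => x y.
by rewrite -dotNl -dotDl mulrC normr_dot_le.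
Qed.

Lemma continuous_enorm : continuous (@enorm R d).
Proof.
apply: (@enorm_lipschitz_continuous _ 1) => x y.
by rewrite mul1r enorm_distN.
Qed.

Lemma compact_enorm_closed (A : set 'rV[R]_d) M :
  closed A -> (forall x, A x -> enorm x <= M) -> compact A.
Proof.
move=> cA hA; apply: bounded_closed_compact => //.
exists M; split; first exact: num_real.
move=> b Mb x Ax /=; rewrite (le_trans (normr_le_enorm x))//.
by rewrite (le_trans (hA _ Ax))// ltW.
Qed.

Lemma closed_enorm (A : set 'rV[R]_d) : compact A -> closed A.
Proof. by move=> cA; apply: compact_closed cA; exact: norm_hausdorff. Qed.

End Euclidean.

(** * Orthogonal projections *)

Section OrthogonalComplement.
Context (R : realType) (d : nat).
Implicit Types (u v w : 'rV[R]_d) (V W : 'M[R]_d) (a : R).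

(** Subspaces are row spaces of square matrices. The entries of [v *m W^T] are the dot products of
    [v] with the rows of [W], so this kernel is the orthogonal complement. *)
Definition orth W : 'M[R]_d := kermx W^T.

Lemma orthP W v : reflect (forall w, (w <= W)%MS -> dot v w = 0) (v <= orth W)%MS.
Proof.
apply: (iffP sub_kermxP) => [h w /submxP[D ->]|h].
  by rewrite dot_mulmx trmx_mul mulmxA h mul0mx mxE.
apply/rowP => i; rewrite mxE [RHS]mxE -[RHS](h (row i W)) ?row_sub//.
by apply: eq_bigr => j _; rewrite !mxE.
Qed.

Lemma dot_orth W v w : (v <= orth W)%MS -> (w <= W)%MS -> dot v w = 0.
Proof. by move=> /orthP h /h. Qed.

Lemma mxrank_orth W : \rank (orth W) = (d - \rank W)%N.
Proof. by rewrite mxrank_ker mxrank_tr. Qed.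

Lemma orth_cap W : (W :&: orth W = 0)%MS.
Proof.
apply/row_matrixP => i; rewrite row0; set v := row i _.
have vs : (v <= W :&: orth W)%MS by exact: row_sub.
apply/eqP; rewrite -dot_eq0; apply/eqP/(@dot_orth W).
  by rewrite (submx_trans vs)// capmxSr.
by rewrite (submx_trans vs)// capmxSl.
Qed.

Lemma orth_full W v : (v <= W + orth W)%MS.
Proof.
apply: submx_full; rewrite /row_full -[\rank _]addn0 -(mxrank0 R d d).
by rewrite -(orth_cap W) mxrank_sum_cap mxrank_orth subnKC// rank_leq_col.
Qed.

Definition proj W v : 'rV[R]_d := v *m proj_mx W (orth W).

Lemma proj_sub W v : (proj W v <= W)%MS.
Proof. exact: proj_mx_sub. Qed.

Lemma proj_orth W v : (v - proj W v <= orth W)%MS.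
Proof. by apply: proj_mx_compl_sub; exact: orth_full. Qed.

Lemma projD W u v : proj W (u + v) = proj W u + proj W v.
Proof. exact: mulmxDl. Qed.

Lemma projZ W a v : proj W (a *: v) = a *: proj W v.
Proof. by rewrite /proj scalemxAl. Qed.

Lemma projB W u v : proj W (u - v) = proj W u - proj W v.
Proof. exact: mulmxBl. Qed.

Lemma proj0 W : proj W 0 = 0.
Proof. exact: mul0mx. Qed.

Lemma proj_id W v : (v <= W)%MS -> proj W v = v.
Proof. by move=> vW; apply: proj_mx_id => //; exact: orth_cap. Qed.

Lemma proj_eq0 W v : (v <= orth W)%MS -> proj W v = 0.
Proof. by move=> vW; apply: proj_mx_0 => //; exact: orth_cap. Qed.

Lemma dot_proj W u v : (v <= W)%MS -> dot (proj W u) v = dot u v.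
Proof.
move=> vW; apply/eqP; rewrite eq_sym -subr_eq0 -dotNl -dotDl.
by rewrite (dot_orth (proj_orth W u)).
Qed.

Lemma proj_sym W u v : dot (proj W u) v = dot u (proj W v).
Proof.
by rewrite -(dot_proj _ (proj_sub W v)) [RHS]dotC (dot_proj _ (proj_sub W u)) dotC.
Qed.

Lemma dot_proj_proj W u v : dot (proj W u) (proj W v) = dot (proj W u) v.
Proof. by rewrite -proj_sym proj_id// proj_sub. Qed.

Lemma orthK W : (orth (orth W) :=: W)%MS.
Proof.
apply/eqmxP; rewrite andbC; have h : (W <= orth (orth W))%MS.
  apply/row_subP => i; apply/orthP => w hw.
  by rewrite dotC (dot_orth hw)// row_sub.
rewrite h /= -mxrank_leqif_sup//.
by rewrite !mxrank_orth subKn// rank_leq_col.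
Qed.

Lemma projC W v : proj (orth W) v = v - proj W v.
Proof.
rewrite -{1}(subrK (proj W v) v) projD (proj_id (proj_orth W v)).
by rewrite (proj_eq0 (W := orth W)) ?addr0// orthK proj_sub.
Qed.

Lemma proj_pythagoras W v :
  enorm v ^+ 2 = enorm (proj W v) ^+ 2 + enorm (proj (orth W) v) ^+ 2.
Proof.
rewrite !sqr_enorm !dot_proj_proj projC -dotDl.
by rewrite [proj W v + _]addrC subrK.
Qed.

Lemma enorm_proj W v : enorm (proj W v) <= enorm v.
Proof.
rewrite -ler_sqr ?nnegrE ?enorm_ge0// (proj_pythagoras W v) lerDl.
exact: sqr_ge0.
Qed.

Lemma proj_eqmx V W v : (V :=: W)%MS -> proj V v = proj W v.
Proof.
move=> VW; rewrite -{1}(subrK (proj W v) v) projD.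
rewrite proj_eq0 ?add0r; first by rewrite proj_id// VW proj_sub.
apply/orthP => w; rewrite VW; exact: dot_orth (proj_orth W v).
Qed.

(** Rank count: the image of [V] under an injective projection is a subspace of [W] of full rank. *)
Lemma proj_injective_full V W :
    \rank V = \rank W -> (forall v, (v <= V)%MS -> proj W v = 0 -> v = 0) ->
  forall w, (w <= W)%MS -> exists2 v, (v <= V)%MS & proj W v = w.
Proof.
move=> rVW inj w wW; set P := proj_mx W (orth W).
have sub : (V *m P <= W)%MS by exact: proj_mx_sub.
have rk : \rank (V *m P) = \rank V.
  apply/mxrank_injP/eqP; apply/row_matrixP => i; rewrite row0; set v := row i _.
  have vs : (v <= V :&: kermx P)%MS by exact: row_sub.
  apply: inj; first by rewrite (submx_trans vs)// capmxSl.
  by apply/sub_kermxP; rewrite (submx_trans vs)// capmxSr.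
have : (W <= V *m P)%MS by rewrite -(mxrank_leqif_sup sub) rk rVW.
move=> /(submx_trans wW) /submxP[D wD]; exists (D *m V); first exact: submxMl.
by rewrite /proj -mulmxA.
Qed.

(* The defect of surjectivity of a projection onto V is the part of V
   orthogonal to its source W. *)
Lemma proj_surjective V W :
    (forall v, (v <= V)%MS -> (v <= orth W)%MS -> v = 0) ->
  forall v, (v <= V)%MS -> exists2 w, (w <= W)%MS & proj V w = v.
Proof.
move=> VW v vV; set P := proj_mx V (orth V).
have sub : (W *m P <= V)%MS by exact: proj_mx_sub.
suff : (V <= W *m P)%MS.
  move=> /(submx_trans vV) /submxP[D vD]; exists (D *m W); first exact: submxMl.
  by rewrite /proj -mulmxA.
(* If [x] is orthogonal to the image of [W], then [proj V x] is orthogonal to [W], because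
   projections are symmetric; by hypothesis it vanishes. *)
rewrite -(orthK (W *m P)); apply/row_subP => i; apply/orthP => x hx.
suff : proj V x = 0.
  by rewrite -[row i V](proj_id (row_sub _ _)) proj_sym => ->; rewrite dot0r.
apply: VW; first exact: proj_sub.
apply/orthP => w wW; rewrite proj_sym (dot_orth hx)//.
exact: submxMr.
Qed.

End OrthogonalComplement.

(** * Angles between flats *)

Lemma ler_acos (R : realType) (x y : R) :
  -1 <= x <= 1 -> -1 <= y <= 1 -> (acos x <= acos y) = (y <= x).
Proof.
move=> x1 y1; have [ax cx] := acos_def x1; have [ay cy] := acos_def y1.
by rewrite -{2}cx -{2}cy [RHS]leNgt ltr_cos ?in_itv// -leNgt.
Qed.

Lemma inf_minimum (R : realType) (A : set R) m :
  A m -> (forall x, A x -> m <= x) -> inf A = m.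
Proof.
move=> Am mA; apply/eqP; rewrite eq_le; apply/andP; split.
  by apply: ge_inf => //; exists m.
by apply: lb_le_inf => //; exists m.
Qed.

Section FlatAngle.
Context (R : realType) (d : nat).
Implicit Types (p q u v w : 'rV[R]_d) (V W : 'M[R]_d) (c : R).

Definition aflat p W : set 'rV[R]_d := [set p + v | v in [set v | (v <= W)%MS]].

Lemma aflatE p W x : aflat p W x <-> (x - p <= W)%MS.
Proof.
split=> [[v /= vW <-]|xW]; first by rewrite addrAC subrr add0r.
by exists (x - p) => //; rewrite addrC subrK.
Qed.

Lemma line_sub_aflat p W a u : line a u `<=` aflat p W <-> (a - p <= W)%MS /\ (u <= W)%MS.
Proof.
split=> [h|[aW uW] _ [t _ <-]]; last first.
  by apply/aflatE; rewrite addrAC addmx_sub// scalemx_sub.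
have aW : (a - p <= W)%MS.
  by apply/aflatE/h; exists 0 => //; rewrite scale0r addr0.
split=> //; rewrite -[u](addrK (a - p)); apply: addmx_sub; last by rewrite eqmx_opp.
by rewrite addrA; apply/aflatE/h; exists 1 => //; rewrite scale1r addrC.
Qed.

Definition proj_angle W u : R := acos (enorm (proj W u) / enorm u).

Lemma proj_ratio W u : 0 <= enorm (proj W u) / enorm u <= 1.
Proof.
rewrite divr_ge0 ?enorm_ge0//=; have [->|u0] := eqVneq u 0.
  by rewrite enorm0 invr0 mulr0.
by rewrite ler_pdivrMr ?enorm_gt0// mul1r enorm_proj.
Qed.

Lemma exists_nonzero_submx V : \rank V != 0%N ->
  exists2 v : 'rV[R]_d, v != 0 & (v <= V)%MS.
Proof.
move=> V0; apply: contrapT => h; move/negP: V0; apply.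
rewrite mxrank_eq0; apply/eqP/row_matrixP => i.
rewrite row0; apply: contrapT => /eqP vi; apply: h.
by exists (row i V) => //; exact: row_sub.
Qed.

(** For [v] in [W] only [proj W u] contributes to [dot u v], so Cauchy-Schwarz gives the bound,
    attained at [v = proj W u]. If this projection is 0, any nonzero vector of [W] attains the right
    angle. *)
Lemma inf_line_angle q W u : \rank W != 0%N -> u != 0 ->
  inf [set beta | exists b v, [/\ v != 0, line b v `<=` aflat q W &
      beta = line_angle u v]] = proj_angle W u.
Proof.
move=> W0 u0; have pu : 0 < enorm u by rewrite enorm_gt0.
have ratio := proj_ratio W u.
apply: inf_minimum => [|_ [b [v [v0 /line_sub_aflat[_ vW] ->]]]]; last first.
  have pv : 0 < enorm v by rewrite enorm_gt0.
  have dle := normr_dot_le (proj W u) v; rewrite dot_proj// in dle.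
  have h0 : 0 <= `|dot u v| / (enorm u * enorm v) <= 1.
    rewrite divr_ge0 ?normr_ge0 ?mulr_ge0 ?enorm_ge0//=.
    by rewrite ler_pdivrMr ?mulr_gt0// mul1r normr_dot_le.
  rewrite ler_acos; try lra.
  rewrite ler_pdivrMr ?mulr_gt0// mulrA divfK ?gt_eqF//.
suff [v [v0 vW h]] : exists v, [/\ v != 0, (v <= W)%MS &
    `|dot u v| = enorm (proj W u) * enorm v].
  exists q, v; split=> //.
    by apply/line_sub_aflat; rewrite subrr sub0mx.
  congr acos; rewrite h invfM mulrACA divff ?mulr1// gt_eqF// enorm_gt0//.
have [Pu0|Pu0] := eqVneq (proj W u) 0.
  have [v v0 vW] := exists_nonzero_submx W0; exists v; split=> //.
  by rewrite -(dot_proj _ vW) Pu0 dot0l enorm0 mul0r normr0.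
exists (proj W u); split; rewrite ?proj_sub//.
by rewrite -(dot_proj _ (proj_sub W u)) -sqr_enorm expr2 normrM ger0_norm ?enorm_ge0.
Qed.

Lemma flat_angleE p q V W : \rank W != 0%N ->
  flat_angle (aflat p V) (aflat q W) =
  sup [set proj_angle W u | u in [set u | u != 0 /\ (u <= V)%MS]].
Proof.
move=> W0; congr sup; apply/seteqP; split.
  move=> _ [a [u [u0 /line_sub_aflat[_ uV] ->]]].
  by exists u => //; rewrite inf_line_angle.
move=> _ [u [u0 uV] <-]; exists p, u; split=> //.
  by apply/line_sub_aflat; rewrite subrr sub0mx.
by rewrite inf_line_angle.
Qed.

(** Turns bounds on angles into lower bounds on lengths of projections, the form in which all later
    comparisons are made. *)
Lemma flat_angle_le p q V W c : \rank V != 0%N -> \rank W != 0%N -> 0 <= c <= 1 ->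
  flat_angle (aflat p V) (aflat q W) <= acos c <->
  (forall u, (u <= V)%MS -> c * enorm u <= enorm (proj W u)).
Proof.
move=> V0 W0 c1; rewrite flat_angleE//; set A := [set _ | _ in _].
have ub : has_ubound A.
  exists pi => _ [u _ <-]; apply: acos_lepi.
  by have := proj_ratio W u; lra.
have memle u : u != 0 ->
    (proj_angle W u <= acos c) = (c * enorm u <= enorm (proj W u)).
  move=> u0; have := proj_ratio W u => ru.
  rewrite ler_acos; try lra.
  by rewrite ler_pdivlMr// enorm_gt0.
split=> [h u uV|h].
  have [->|u0] := eqVneq u 0; first by rewrite enorm0 mulr0 enorm_ge0.
  rewrite -memle//; apply: le_trans h; apply: ub_le_sup => //.
  by exists u.
apply: ge_sup.
  by have [v v0 vV] := exists_nonzero_submx V0; exists (proj_angle W v), v.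
by move=> _ [u [u0 uV] <-]; rewrite memle// h.
Qed.

Lemma flat_angle_ge0 p q V W : \rank V != 0%N -> \rank W != 0%N ->
  0 <= flat_angle (aflat p V) (aflat q W).
Proof.
move=> V0 W0; rewrite flat_angleE//.
have [v v0 vV] := exists_nonzero_submx V0.
have ge0 : 0 <= proj_angle W v.
  by apply: acos_ge0; have := proj_ratio W v; lra.
apply: le_trans ge0 _; apply: ub_le_sup; last by exists v.
exists pi => _ [u _ <-]; apply: acos_lepi.
by have := proj_ratio W u; lra.
Qed.

Lemma flat_angle_acos p q V W : \rank V != 0%N -> \rank W != 0%N ->
  exists2 c, 0 <= c <= 1 & flat_angle (aflat p V) (aflat q W) = acos c.
Proof.
move=> V0 W0; have h0 := flat_angle_ge0 p q V0 W0.
have h1 : flat_angle (aflat p V) (aflat q W) <= pi / 2.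
  rewrite -acos0; apply/flat_angle_le => //; first by rewrite lexx ler01.
  by move=> u _; rewrite mul0r enorm_ge0.
exists (cos (flat_angle (aflat p V) (aflat q W))).
  rewrite cos_le1 andbT cos_ge0_pihalf//.
  by have := pi_ge0 R; lra.
rewrite cosK// in_itv /= h0 /=.
by have := pi_ge0 R; lra.
Qed.

(** Each of the two angles is itself some [acos c], so angles with the same upper bounds of this
    form are equal. *)
Lemma flat_angle_eq p q p' q' V W V' W' :
    \rank V != 0%N -> \rank W != 0%N -> \rank V' != 0%N -> \rank W' != 0%N ->
    (forall c, 0 <= c <= 1 ->
      (forall u, (u <= V)%MS -> c * enorm u <= enorm (proj W u)) <->
      (forall u, (u <= V')%MS -> c * enorm u <= enorm (proj W' u))) ->
  flat_angle (aflat p V) (aflat q W) = flat_angle (aflat p' V') (aflat q' W').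
Proof.
move=> V0 W0 V0' W0' h; apply/eqP; rewrite eq_le; apply/andP; split.
  have [c c1 E] := flat_angle_acos p' q' V0' W0'.
  rewrite E; apply/flat_angle_le => //; apply/h => //.
  by apply/(flat_angle_le p' q' V0' W0' c1); rewrite E.
have [c c1 E] := flat_angle_acos p q V0 W0.
rewrite E; apply/flat_angle_le => //; apply/h => //.
by apply/(flat_angle_le p q V0 W0 c1); rewrite E.
Qed.

(** For c > 0 the projection from [V] to [W] is injective, hence onto. Writing w = proj W v gives
    |w|^2 = dot (proj V w) v <= |proj V w| |v|, and c |v| <= |w|. *)
Lemma proj_ge_sym V W c : \rank V = \rank W -> 0 <= c ->
    (forall u, (u <= V)%MS -> c * enorm u <= enorm (proj W u)) ->
  forall w, (w <= W)%MS -> c * enorm w <= enorm (proj V w).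
Proof.
move=> rVW c0 h w wW; move: c0; rewrite le_eqVlt => /predU1P[<-|c0].
  by rewrite mul0r enorm_ge0.
have [|v vV Pv] := @proj_injective_full _ _ V W rVW _ w wW.
  move=> v vV Pv; apply/eqP; rewrite -enorm_eq0 eq_le enorm_ge0 andbT.
  by rewrite -(pmulr_rle0 _ c0) (le_trans (h v vV))// Pv enorm0.
have [->|v0] := eqVneq w 0; first by rewrite enorm0 mulr0 enorm_ge0.
have vw : dot (proj V w) v = enorm w ^+ 2.
  by rewrite dot_proj// dotC -(dot_proj _ wW) Pv sqr_enorm.
have nw : 0 < enorm w by rewrite enorm_gt0.
have cv := h v vV; rewrite Pv in cv.
have le1 := dot_le (proj V w) v; rewrite vw in le1.
have nPw := enorm_ge0 (proj V w).
rewrite -(ler_pM2r nw) -mulrA -expr2.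
apply: (@le_trans _ _ (c * (enorm (proj V w) * enorm v))).
  by rewrite ler_pM2l.
by rewrite mulrCA ler_wpM2l.
Qed.

(* Both conditions say that dot u n <= sqrt (1 - c^2) |u| |n| for u in V and
   n in orth W. *)
Lemma proj_ge_orth V W c : 0 <= c <= 1 ->
    (forall u, (u <= V)%MS -> c * enorm u <= enorm (proj W u)) ->
  forall n, (n <= orth W)%MS -> c * enorm n <= enorm (proj (orth V) n).
Proof.
move=> /andP[c0 c1] h n nW; rewrite -ler_sqr ?nnegrE ?mulr_ge0 ?enorm_ge0//.
have := proj_pythagoras V n; set u := proj V n => E.
have uV : (u <= V)%MS by exact: proj_sub.
have hu : enorm u ^+ 2 = dot (proj (orth W) u) n.
  by rewrite dot_proj// sqr_enorm dot_proj_proj.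
have := proj_pythagoras W u => E2.
have hc : c ^+ 2 * enorm u ^+ 2 <= enorm (proj W u) ^+ 2.
  by rewrite -exprMn ler_sqr ?nnegrE ?mulr_ge0 ?enorm_ge0// h.
have le1 : (enorm u ^+ 2) ^+ 2 <= enorm (proj (orth W) u) ^+ 2 * enorm n ^+ 2.
  by rewrite -exprMn ler_sqr ?nnegrE ?mulr_ge0 ?enorm_ge0 ?sqr_ge0// hu dot_le.
rewrite exprMn; have [u0|u0] := eqVneq u 0.
  have nn : enorm n ^+ 2 >= 0 by exact: sqr_ge0.
  rewrite u0 enorm0 expr0n /= add0r in E; rewrite -E.
  by rewrite ler_piMl// expr_le1.
have u2 : 0 < enorm u ^+ 2 by rewrite exprn_gt0// enorm_gt0.
have n2 : 0 <= enorm n ^+ 2 by rewrite sqr_ge0.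
have : enorm u ^+ 2 <= (1 - c ^+ 2) * enorm n ^+ 2.
  rewrite -(ler_pM2l u2) -expr2 (le_trans le1)// [leRHS]mulrA ler_wpM2r//.
  by clear -E2 hc; lra.
by move=> h1; clear -h1 E; lra.
Qed.

End FlatAngle.

(** * Nearest points and empty balls *)

Section NearestPoint.
Context (R : realType) (d : nat) (S : set 'rV[R]_d).
Implicit Types (a b e m p x y : 'rV[R]_d) (c r s t : R).

Definition unique_nearest x := forall a b,
  nearest_point S x a -> nearest_point S x b -> a = b.

Lemma dist_setE x a : nearest_point S x a -> dist_set x S = dist x a.
Proof.
move=> [Sa ha]; apply: inf_minimum; first by exists a.
by move=> _ [b Sb <-]; exact: ha.
Qed.

Lemma continuous_dist x : continuous (dist x).
Proof.
apply: (@enorm_lipschitz_continuous _ _ _ 1) => y z; rewrite mul1r /dist.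
rewrite (le_trans (enorm_distN _ _))// (_ : x - y - _ = z - y) 1?enormB//.
by apply/rowP => i; rewrite !mxE; ring.
Qed.

Hypothesis cS : compact S.

Lemma nearest_point_exists x : S !=set0 -> exists a, nearest_point S x a.
Proof.
move=> S0; have cf := continuous_subspaceT (A := S) (@continuous_dist x).
have [a Sa ha] := compact_EVT_min S0 cS cf.
exists a; split; first by rewrite inE in Sa.
by move=> b Sb; apply: ha; rewrite inE.
Qed.

Lemma dist_set_near x y : S !=set0 -> dist_set x S <= dist_set y S + enorm (x - y).
Proof.
move=> S0; have [a na] := nearest_point_exists x S0.
have [b nb] := nearest_point_exists y S0.
rewrite (dist_setE na) (dist_setE nb); case: na => _ /(_ b nb.1) h.
by rewrite (le_trans h)// addrC enormD_triangle.
Qed.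

Lemma continuous_dist_set : S !=set0 -> continuous (fun x => dist_set x S).
Proof.
move=> S0; apply: (@enorm_lipschitz_continuous _ _ _ 1) => x y; rewrite mul1r.
rewrite ler_norml lerNl opprB !lerBlDl [in X in X && _]enormB.
by rewrite !dist_set_near.
Qed.

(** Points [b] of [S] seen from [y] nearly in the direction of [a] recede at rate at least [c]. The
    others form a compact set [K] that misses [a], so by uniqueness they are farther than [a] by a
    fixed gap, which absorbs a short move. *)
Lemma dist_set_growth y a c : nearest_point S y a -> y != a ->
    unique_nearest y -> 0 < c < 1 ->
  exists2 h0 : R, 0 < h0 & forall h : R, 0 < h <= h0 -> forall b, S b ->
    dist y a + c * h <= dist (y + (h / dist y a) *: (y - a)) b.
Proof.
move=> na ya uy /andP[c0 c1]; set f := dist y a.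
have f0 : 0 < f by rewrite enorm_gt0 subr_eq0.
set K := S `&` [set b | dot (y - b) (y - a) <= c * f ^+ 2].
have far (h : R) b : 0 < h -> c * f ^+ 2 < dot (y - b) (y - a) -> S b ->
    f + c * h <= dist (y + (h / f) *: (y - a)) b.
  move=> h0 hb Sb.
  have f2 : f ^+ 2 <= dot (y - b) (y - b).
    by rewrite -sqr_enorm ler_sqr ?nnegrE ?enorm_ge0//; exact: na.2.
  rewrite /dist enorm_ge; last by rewrite addr_ge0 ?mulr_ge0// ltW.
  have -> : y + (h / f) *: (y - a) - b = (y - b) + (h / f) *: (y - a).
    by rewrite addrAC.
  have ee : dot (y - a) (y - a) = f ^+ 2 by rewrite -sqr_enorm.
  move: hb f2 ee; move: (y - b) (y - a) => v e hb f2 ee.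
  rewrite !dotE ee (dotC e v).
  have -> : h / f * (h / f * f ^+ 2) = h ^+ 2.
    by rewrite mulrA -!expr2 -exprMn divfK ?gt_eqF.
  have h1 : c * h * f <= h / f * dot v e.
    rewrite [leRHS]mulrAC ler_pdivlMr//.
    rewrite (_ : c * h * f * f = h * (c * f ^+ 2)); last by ring.
    by rewrite ler_pM2l// ltW.
  have h2 : (c * h) ^+ 2 <= h ^+ 2.
    by rewrite exprMn ler_piMl ?sqr_ge0// expr_le1 ?ltW.
  clear -h1 h2 f2.
  rewrite sqrrD; lra.
have [K0|K0] := pselect (K !=set0); last first.
  exists 1 => // h /andP[h0 _] b Sb; apply: far => //.
  by rewrite ltNge; apply/negP => hb; apply: K0; exists b.
have cK : compact K.
  apply: (subclosed_compact _ cS) => [|x []//]; apply: closedI.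
    exact: closed_enorm.
  have -> : [set b | dot (y - b) (y - a) <= c * f ^+ 2] =
      (fun b => dot b (y - a)) @^-1` [set z | dot y (y - a) - c * f ^+ 2 <= z].
    by apply/seteqP; split=> b /=; rewrite dotDl dotNl; lra.
  by apply: preimage_closed; [move=> x _; exact: continuous_dotr|exact: closed_ge].
have [b0 Kb0 hb0] :=
  compact_EVT_min K0 cK (continuous_subspaceT (A := K) (@continuous_dist y)).
rewrite inE in Kb0; have [Sb0 dKb0] := Kb0.
have fm : f < dist y b0.
  rewrite lt_neqAle (na.2 _ Sb0) andbT; apply/negP => /eqP E.
  have ab0 : a = b0.
    by apply: uy => //; split=> // b Sb; rewrite -E; exact: na.2.
  move: dKb0; rewrite /= -ab0 -sqr_enorm -/(dist y a) -/f.
  by rewrite leNgt gtr_pMl ?exprn_gt0// c1.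
(* Half of the gap covers the displacement [h], the other half the growth [c * h]. *)
exists ((dist y b0 - f) / 2); first by rewrite divr_gt0// subr_gt0.
move=> h /andP[h0 hh] b Sb.
have [hb|hb] := ltP (c * f ^+ 2) (dot (y - b) (y - a)); first exact: far.
have hm : dist y b0 <= dist y b by apply: hb0; rewrite inE.
have : enorm (y - b) <= enorm (y + (h / f) *: (y - a) - b) + h.
  have -> : y - b = y + (h / f) *: (y - a) - b + - ((h / f) *: (y - a)).
    by rewrite addrAC addrK.
  apply: le_trans (enormD _ _) _; rewrite lerD2l enormN enormZ.
  by rewrite gtr0_norm ?divr_gt0// -/(dist y a) -/f divfK ?gt_eqF.
rewrite -/(dist y b) -/(dist _ b); nra.
Qed.

(* Maximise dist_set _ S - c dist _ x0 over the ball: by dist_set_growth the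
   maximum is on the boundary sphere, and c -> 1 forces it onto the ray. *)
Lemma nearest_point_extend x0 p r : nearest_point S x0 p -> x0 != p -> 0 <= r ->
    (forall y, dist y x0 < r -> unique_nearest y) ->
  nearest_point S (x0 + (r / dist x0 p) *: (x0 - p)) p.
Proof.
move=> np xp; rewrite le_eqVlt => /predU1P[<-|r0] huniq.
  by rewrite mul0r scale0r addr0.
have S0 : S !=set0 by exists p; exact: np.1.
pose f y := dist_set y S; set f0 := dist x0 p.
have fx0 : f x0 = f0 by exact: dist_setE.
have f0gt : 0 < f0 by rewrite enorm_gt0 subr_eq0.
have cf : continuous f by exact: continuous_dist_set.
set K := [set y | enorm (y - x0) <= r].
have Kx0 : K x0 by rewrite /K /= subrr enorm0 ltW.
have cn : continuous (fun y => enorm (y - x0)).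
  apply: (@enorm_lipschitz_continuous _ _ _ 1) => y z; rewrite mul1r.
  by rewrite (le_trans (enorm_distN _ _))// opprB addrA subrK.
have cK : compact K.
  apply: (@compact_enorm_closed _ _ _ (r + enorm x0)) => [|y yK].
    rewrite /K (_ : [set _ | _] = (fun y => enorm (y - x0)) @^-1` [set z | z <= r])//.
    by apply: preimage_closed; [move=> y _; exact: cn|exact: closed_le].
  by rewrite -(subrK x0 y) (le_trans (enormD _ _))// lerD2r.
have K0 : K !=set0 by exists x0.
have [ys ysK hys] := compact_EVT_max K0 cK (continuous_subspaceT (A := K) cf).
rewrite inE in ysK.
have low c : 0 < c < 1 -> f0 + c * r <= f ys.
  move=> /andP[c0 c1]; pose g y := f y - c * enorm (y - x0).
  have cg : continuous g.
    move=> y; apply: (@continuousB _ R^o _ f (fun y => c * enorm (y - x0)) y (cf y)).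
    by apply: (@continuousM _ _ (fun=> c) _ y _ (cn y)); exact: cst_continuous.
  have [y yK hy] := compact_EVT_max K0 cK (continuous_subspaceT (A := K) cg).
  rewrite inE in yK; have := hys y; rewrite inE => /(_ yK); apply: le_trans.
  have gy0 : f0 <= g y.
    have := hy x0; rewrite inE => /(_ Kx0).
    by rewrite /g subrr enorm0 mulr0 subr0 fx0.
  suff yr : enorm (y - x0) = r by rewrite -lerBrDr -yr.
  apply/eqP; move: (yK : enorm (y - x0) <= r).
  rewrite le_eqVlt => /orP[//|yr]; exfalso.
  have [a na] := nearest_point_exists y S0.
  have fy : f y = dist y a by exact: dist_setE.
  have ya : y != a.
    rewrite -subr_eq0 -enorm_gt0 -/(dist y a) -fy (lt_le_trans f0gt)//.
    by rewrite (le_trans gy0)// /g lerBlDr lerDl mulr_ge0 ?enorm_ge0// ltW.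
  (* A growth rate strictly between [c] and 1 beats the penalty of slope [c], so [g] has no maximum
     inside the ball. *)
  pose c' := (c + 1) / 2; have c'1 : 0 < c' < 1 by rewrite /c'; lra.
  have [h0 h0gt grow] := dist_set_growth na ya (huniq y yr) c'1.
  pose h := Num.min h0 (r - enorm (y - x0)).
  have hgt : 0 < h by rewrite lt_min h0gt subr_gt0.
  have hle : h <= h0 by rewrite ge_min lexx.
  have hle2 : h <= r - enorm (y - x0) by rewrite ge_min lexx orbT.
  set z := y + (h / dist y a) *: (y - a).
  have [b nb] := nearest_point_exists z S0.
  have fz : f y + c' * h <= f z.
    rewrite fy [f z](dist_setE nb); apply: grow; last exact: nb.1.
    by rewrite hgt.
  have zx : enorm (z - x0) <= enorm (y - x0) + h.
    rewrite /z addrAC (le_trans (enormD _ _))// lerD2l enormZ.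
    rewrite -/(dist y a) gtr0_norm ?divfK ?divr_gt0//.
      by rewrite gt_eqF// enorm_gt0 subr_eq0.
    by rewrite enorm_gt0 subr_eq0.
  have zK : K z by rewrite /K /= (le_trans zx)// -lerBrDl.
  have := hy z; rewrite inE => /(_ zK); rewrite /g => gz.
  have : c * enorm (z - x0) <= c * (enorm (y - x0) + h) by rewrite ler_pM2l.
  by rewrite /c' in fz; nra.
have top : f0 + r <= f ys.
  have half := low (1 / 2) ltac:(lra).
  rewrite leNgt; apply/negP => lt1.
  (* [t] is the rate of growth reached at [ys]; if it were below 1, [low] with a constant between
     [t] and 1 would be violated. *)
  pose t := (f ys - f0) / r.
  have tr : t * r = f ys - f0 by rewrite divfK ?gt_eqF.
  have t1 : t < 1 by rewrite ltr_pdivrMr//; lra.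
  have t0 : 0 < t by rewrite divr_gt0//; lra.
  have := low ((t + 1) / 2) ltac:(lra); nra.
have yp : f ys <= dist ys p.
  have [a na] := nearest_point_exists ys S0.
  by rewrite [f ys](dist_setE na); exact: na.2 np.1.
have [v vE] : exists v, v = ys - x0 by exists (ys - x0).
have [w wE] : exists w, w = x0 - p by exists (x0 - p).
have nv : dot v v <= r ^+ 2 by rewrite -enorm_le ?(ltW r0)// vE.
have nw : dot w w = f0 ^+ 2 by rewrite -sqr_enorm wE.
have ypE : ys - p = v + w by rewrite vE wE addrA subrK.
have nvw : (f0 + r) ^+ 2 <= dot (v + w) (v + w).
  rewrite -enorm_ge -?ypE ?(le_trans top)//.
  by rewrite addr_ge0// ltW.
(* Equality case of the triangle inequality: |v| <= r, |w| = f0 and |v + w| >= f0 + r force v = (r /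
   f0) w, so the maximiser lies on the ray. *)
have vw : r * f0 <= dot v w.
  by move: nvw; rewrite !dotE (dotC w v) nw; clear -nv; nra.
have ysE : ys = x0 + (r / f0) *: w.
  apply/eqP; rewrite addrC -subr_eq -subr_eq0 -dot_eq0 eq_le dot_ge0 andbT.
  have [t tE] : exists t, t = r / f0 by exists (r / f0).
  have tt : t * (t * f0 ^+ 2) = r ^+ 2.
    by rewrite tE mulrA -!expr2 -exprMn divfK ?gt_eqF.
  have : r ^+ 2 <= t * dot v w.
    by rewrite tE mulrAC ler_pdivlMr// expr2 -mulrA ler_pM2l.
  rewrite -vE -tE !dotE (dotC w v) nw.
  clear -nv tt; lra.
rewrite -wE -ysE; split=> [|b Sb]; first exact: np.1.
have -> : dist ys p = f ys.
  apply/eqP; rewrite eq_le yp andbT (le_trans _ top)// /dist ypE.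
  by rewrite (le_trans (enormD _ _))// addrC lerD// ?wE// vE.
have [a na] := nearest_point_exists ys S0.
by rewrite [f ys](dist_setE na); exact: na.2.
Qed.

(** Expanding the squares makes emptiness of the ball linear in its radius [s], from which
    monotonicity and passage to suprema are immediate. *)
Lemma nearest_pointP b m s : S b -> enorm m = 1 -> 0 <= s ->
  nearest_point S (b + s *: m) b <->
  forall b', S b' -> 2 * s * dot m (b' - b) <= dot (b' - b) (b' - b).
Proof.
move=> Sb m1 s0; have mm : dot m m = 1 by rewrite -sqr_enorm m1 expr1n.
have E b' : (dist (b + s *: m) b <= dist (b + s *: m) b') =
    (2 * s * dot m (b' - b) <= dot (b' - b) (b' - b)).
  rewrite /dist addrAC subrr add0r enorm_le ?enorm_ge0// sqr_enorm.
  rewrite (_ : b + s *: m - b' = s *: m - (b' - b)); last first.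
    by apply/rowP => i; rewrite !mxE; ring.
  move: (b' - b) => w; rewrite !dotE (dotC w m) mm.
  by apply/idP/idP; lra.
split=> [[_ h] b' /h|h]; first by rewrite E.
by split=> // b' /h; rewrite E.
Qed.

(** Continuation in the radius: by [nearest_pointP] the supremum [u] of the admissible radii is
    admissible, and [nearest_point_extend] would push it further if u < t. The initial radius [s0]
    keeps the centre away from [b], as that extension requires. *)
Lemma nearest_point_ray b m s0 t : S b -> enorm m = 1 -> 0 < s0 -> 0 <= t ->
    nearest_point S (b + s0 *: m) b ->
    (forall s, 0 < s < t -> exists2 r, 0 < r &
      forall y, dist y (b + s *: m) < r -> unique_nearest y) ->
  nearest_point S (b + t *: m) b.
Proof.
move=> Sb m1 s0gt t0 near0 hu.
pose A := [set s | 0 <= s <= t /\ nearest_point S (b + s *: m) b].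
have down s s' : 0 <= s' <= s -> nearest_point S (b + s *: m) b ->
    nearest_point S (b + s' *: m) b.
  move=> /andP[s'0 ss'] /(nearest_pointP Sb m1 (le_trans s'0 ss')) h.
  apply/nearest_pointP => // b' Sb'; have := h _ Sb'.
  have [mb _|mb] := leP (dot m (b' - b)) 0.
    by rewrite (le_trans _ (dot_ge0 _))// mulr_ge0_le0// mulr_ge0.
  by apply: le_trans; rewrite ler_pM2r// ler_pM2l.
have A0 : A (Num.min s0 t).
  have h1 : 0 <= Num.min s0 t by rewrite le_min t0 ltW.
  split; first by rewrite h1 ge_min lexx orbT.
  by apply: down near0; rewrite h1 ge_min lexx.
have ubA : has_ubound A by exists t => s [/andP[]].
set u := sup A; have hsupA : has_sup A by split=> //; exists (Num.min s0 t).
have u0 : 0 <= u by apply: le_trans (ub_le_sup ubA A0); rewrite le_min t0 ltW.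
have ut : u <= t by apply: ge_sup; [exists (Num.min s0 t)|move=> s [/andP[]]].
have nu : nearest_point S (b + u *: m) b.
  apply/nearest_pointP => // b' Sb'.
  have [mb|mb] := leP (dot m (b' - b)) 0.
    by rewrite (le_trans _ (dot_ge0 _))// mulr_ge0_le0// mulr_ge0.
  rewrite -ler_pdivlMr// mulrC -ler_pdivlMr//.
  apply: ge_sup; first by exists (Num.min s0 t).
  move=> s [/andP[s_ge0 _] /(nearest_pointP Sb m1 s_ge0) /(_ _ Sb')].
  by rewrite -ler_pdivlMr// mulrC -ler_pdivlMr.
move: ut; rewrite le_eqVlt => /predU1P[<-//|ut]; exfalso.
have ugt : 0 < u.
  by apply: lt_le_trans (ub_le_sup ubA A0); rewrite lt_min s0gt (le_lt_trans u0).
have [r r0 hr] := hu u ltac:(by rewrite ugt).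
pose e := Num.min r (t - u).
have e0 : 0 < e by rewrite lt_min r0 subr_gt0.
have dE : dist (b + u *: m) b = u.
  by rewrite /dist addrAC subrr add0r enormZ m1 mulr1 gtr0_norm.
have := @nearest_point_extend _ _ e nu _ (ltW e0).
have bu : b + u *: m - b = u *: m by rewrite addrAC subrr add0r.
rewrite dE bu scalerA divfK ?gt_eqF// -addrA -scalerDl => h.
have : A (u + e).
  split; first by rewrite addr_ge0 ?(ltW e0)//= -lerBrDl ge_min lexx orbT.
  apply: h.
    by rewrite -subr_eq0 addrAC subrr add0r -enorm_gt0 enormZ m1 mulr1 gtr0_norm.
  by move=> y hy; apply: hr; rewrite (lt_le_trans hy)// ge_min lexx.
by move/(ub_le_sup ubA); rewrite -/u gerDl leNgt e0.
Qed.

End NearestPoint.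

(** * Continuity of projections, norms and dot products, and closed sets they define *)

Lemma enorm_lipschitz_map (R : realType) d e (f : 'rV[R]_d -> 'rV[R]_e) C :
  (forall x y, enorm (f x - f y) <= C * enorm (x - y)) -> continuous f.
Proof.
move=> hf x A /nbhs_enormP[r r0 rA]; have C0 : 0 < `|C| + 1 by rewrite ltr_wpDl.
apply/nbhs_enormP; exists (r / (`|C| + 1)); first by rewrite divr_gt0.
move=> y; rewrite ltr_pdivlMr// mulrC => hy.
apply: rA; apply: le_lt_trans (hf _ _) (le_lt_trans _ hy).
by rewrite ler_wpM2r ?enorm_ge0// ler_wpDr// ler_norm.
Qed.

Lemma continuous_proj (R : realType) d (W : 'M[R]_d) : continuous (proj W).
Proof.
apply: (@enorm_lipschitz_map _ _ _ _ 1) => x y.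
by rewrite -projB mul1r enorm_proj.
Qed.

Section ContinuityOnTopologicalSpaces.
Context (R : realType) (T : topologicalType).

Lemma continuous_enorm_comp d (f : T -> 'rV[R]_d) :
  continuous f -> continuous (fun x => enorm (f x)).
Proof.
by move=> cf x; apply: continuous_comp; [exact: cf|exact: continuous_enorm].
Qed.

(** By polarization, from the continuity of [enorm]. *)
Lemma continuous_dot d (f g : T -> 'rV[R]_d) :
  continuous f -> continuous g -> continuous (fun x => dot (f x) (g x)).
Proof.
move=> cf cg; have -> : (fun x => dot (f x) (g x)) =
    (fun x => 4^-1 * (enorm (f x + g x) ^+ 2 - enorm (f x - g x) ^+ 2)).
  apply/funext => x; rewrite !sqr_enorm !dotE (dotC (g x)).
  by field.
have cD : continuous (fun x => f x + g x).
  by move=> x; apply: continuousD; [exact: cf|exact: cg].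
have cB : continuous (fun x => f x - g x).
  by move=> x; apply: continuousB; [exact: cf|exact: cg].
have cX h : continuous h -> continuous (fun x : T => (h x : R) ^+ 2).
  by move=> ch x; apply: (@continuousM _ _ h h x (ch x) (ch x)).
move=> x; apply: (@continuousM _ _ (fun=> 4^-1) _ x).
  exact: cst_continuous.
apply: (@continuousB _ R^o _ (fun x => enorm (f x + g x) ^+ 2)
  (fun x => enorm (f x - g x) ^+ 2) x).
  exact: cX (continuous_enorm_comp cD) x.
exact: cX (continuous_enorm_comp cB) x.
Qed.

Lemma closed_le_cst (f : T -> R) c : continuous f -> closed [set x | f x <= c].
Proof.
move=> cf; rewrite (_ : [set _ | _] = f @^-1` [set z | z <= c])//.
by apply: preimage_closed; [move=> x _; exact: cf|exact: closed_le].
Qed.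

Lemma closed_ge_cst (f : T -> R) c : continuous f -> closed [set x | c <= f x].
Proof.
move=> cf; rewrite (_ : [set _ | _] = f @^-1` [set z | c <= z])//.
by apply: preimage_closed; [move=> x _; exact: cf|exact: closed_ge].
Qed.

Lemma closed_eq_cst (f : T -> R) c : continuous f -> closed [set x | f x = c].
Proof.
move=> cf; rewrite (_ : [set _ | _] = f @^-1` [set c])//.
by apply: preimage_closed; [move=> x _; exact: cf|exact: closed_eq].
Qed.

End ContinuityOnTopologicalSpaces.

(** * The crossing argument *)

(* The inequalities of the scaled problem: a = |c_N|, y = |b_N|, and
   b_T = l c_T, where |c| = 1 and N, T are normal and tangent parts. *)
Section CrossingInequalities.
Context (R : realType).
Implicit Types a l r y : R.

(** The ball condition reads (1 - y)^2 >= 1 - |b_T|^2, and l <= 1 / r gives |b_T|^2 <= (1 - a) / 2,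
    so (1 - y)^2 >= (r / 2)^2; y < 1 selects the root near p. *)
Lemma crossing_small a l r y : 0 <= a <= 1 -> 0 < r -> r ^+ 2 = 2 + 2 * a ->
    0 <= l -> l * r <= 1 -> 0 <= y < 1 ->
    2 * y <= l ^+ 2 * (1 - a ^+ 2) + y ^+ 2 ->
  y <= 1 - r / 2.
Proof.
move=> /andP[a0 a1] r0 rE l0 lr /andP[y0 y1] hy.
have l2 : l ^+ 2 * r ^+ 2 <= 1 by rewrite -exprMn expr_le1// mulr_ge0// ltW.
have la : l ^+ 2 * (1 - a ^+ 2) <= (1 - a) / 2.
  rewrite rE in l2; rewrite (_ : 1 - a ^+ 2 = (1 + a) * (1 - a)); last by ring.
  by rewrite mulrA; nra.
have h : (r / 2) ^+ 2 <= (1 - y) ^+ 2 by rewrite expr_div_n rE; lra.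
have : r / 2 <= 1 - y.
  by rewrite -ler_sqr ?nnegrE ?subr_ge0 ?divr_ge0// ?ltW.
lra.
Qed.

(** The extreme value y = 1 - r / 2 gives a + y = r (r - 1) / 2, and the tangential term is (r -
    1)^2 (4 - r^2) / 4; the two contributions add up to exactly (r - 1)^2. *)
Lemma crossing_full a l r y : 0 <= a <= 1 -> 0 < r -> r ^+ 2 = 2 + 2 * a ->
    l * r = 1 -> 0 <= y < 1 -> 2 * y <= l ^+ 2 * (1 - a ^+ 2) + y ^+ 2 ->
  (1 - l) ^+ 2 * (1 - a ^+ 2) + (a + y) ^+ 2 <= (r - 1) ^+ 2.
Proof.
move=> a01 r0 rE lr y01 hy.
have l0 : 0 <= l by rewrite -(pmulr_lge0 _ r0) lr.
have lr' : l * r <= 1 by rewrite lr.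
have yr := crossing_small a01 r0 rE l0 lr' y01 hy.
have [a0 a1] := andP a01; have [y0 y1] := andP y01.
have aE : a = r ^+ 2 / 2 - 1 by rewrite rE; field.
have h1 : (a + y) ^+ 2 <= (r * (r - 1) / 2) ^+ 2.
  rewrite ler_sqr ?nnegrE ?addr_ge0//; first by rewrite aE; lra.
  by rewrite divr_ge0// mulr_ge0 ?(ltW r0)//; nra.
have -> : (1 - l) ^+ 2 * (1 - a ^+ 2) = (r - 1) ^+ 2 * (4 - r ^+ 2) / 4.
  have -> : l = r^-1 by rewrite -[l]mulr1 -(divff (lt0r_neq0 r0)) mulrA lr mul1r.
  by rewrite aE; field; rewrite lt0r_neq0.
apply: (le_trans (lerD (lexx _) h1)).
by rewrite le_eqVlt; apply/orP; left; apply/eqP; field.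
Qed.

(** The bounds (1 - a) / 2 and (1 - r / 2)^2 on the two parts of |b|^2 add up to 2 - r. Since r >=
    sqrt 2, [b] stays within radius sqrt (2 - sqrt 2). *)
Lemma crossing_partial_radius a l r y : 0 <= a <= 1 -> 0 < r ->
    r ^+ 2 = 2 + 2 * a -> 0 <= l -> l * r <= 1 -> 0 <= y < 1 ->
    2 * y <= l ^+ 2 * (1 - a ^+ 2) + y ^+ 2 ->
  l ^+ 2 * (1 - a ^+ 2) + y ^+ 2 <= 2 - r.
Proof.
move=> a01 r0 rE l0 lr y01 hy.
have yr := crossing_small a01 r0 rE l0 lr y01 hy.
have [a0 a1] := andP a01; have [y0 y1] := andP y01.
have l2 : l ^+ 2 * r ^+ 2 <= 1 by rewrite -exprMn expr_le1// mulr_ge0// ltW.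
have la : l ^+ 2 * (1 - a ^+ 2) <= (1 - a) / 2.
  rewrite rE in l2; rewrite (_ : 1 - a ^+ 2 = (1 + a) * (1 - a)); last by ring.
  by rewrite mulrA; nra.
have : y ^+ 2 <= (1 - r / 2) ^+ 2 by rewrite ler_sqr ?nnegrE//; lra.
by rewrite sqrrB expr_div_n rE; lra.
Qed.

(** As |c| = 1, this says that 0 and c are seen from [b] under an obtuse angle, even for the worst
    direction of b_N. Expanded, it reads y^2 + a y < l (1 - l) (1 - a^2). *)
Lemma crossing_partial a l r y : 0 <= a <= 1 -> 0 < r ->
    r ^+ 2 = 2 + 2 * a -> 0 <= l -> l * r <= 1 -> 0 <= y < 1 ->
    2 * y <= l ^+ 2 * (1 - a ^+ 2) + y ^+ 2 ->
    0 < l ^+ 2 * (1 - a ^+ 2) + y ^+ 2 ->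
  (1 - l) ^+ 2 * (1 - a ^+ 2) + (a + y) ^+ 2 <
  1 - (l ^+ 2 * (1 - a ^+ 2) + y ^+ 2).
Proof.
move=> a01 r0 rE l0 lr y01 hy pos.
have yr := crossing_small a01 r0 rE l0 lr y01 hy.
have [a0 a1] := andP a01; have [y0 y1] := andP y01.
have r1 : 1 < r by nra.
set X := l ^+ 2 * (1 - a ^+ 2) in hy pos *.
have a2 : 0 <= 1 - a ^+ 2 by nra.
have X0 : 0 <= X by rewrite mulr_ge0 ?sqr_ge0.
have h1 : (r - 1) * X <= l * (1 - l) * (1 - a ^+ 2).
  rewrite /X -subr_ge0 (_ : _ - _ = l * (1 - a ^+ 2) * (1 - l * r)); last by ring.
  by rewrite !mulr_ge0// subr_ge0.
suff : y ^+ 2 + a * y < (r - 1) * X by rewrite /X in h1 *; nra.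
have [y00|yn0] := eqVneq y 0.
  by rewrite y00 expr0n mulr0 /= addr0 mulr_gt0 ?subr_gt0//; rewrite y00 in pos; lra.
have yp : 0 < y by rewrite lt_def yn0.
(* The ball condition gives X >= y (2 - y), so a factor [y] cancels; with y <= 1 - r / 2 what
   remains reduces to r > 1. *)
have : y + a < (r - 1) * (2 - y).
  by rewrite (_ : a = r ^+ 2 / 2 - 1); [nra|rewrite rE; field].
by rewrite -(ltr_pM2l yp); nra.
Qed.

End CrossingInequalities.

(* Combines the two bounds 1 + t <= sqrt (2 + 2 |y + t x|) and its analogue for
   -t', where t t' = s^2; X, Y, Z stand for |x|^2, |y|^2, x.y and U, V for
   |y + t x|, |y - t' x|. *)
Lemma two_sided_bound (R : realType) (s t t' X Y Z U V : R) :
  0 < s -> 0 < t -> 0 < t' -> t * t' = s ^+ 2 -> 0 <= U -> 0 <= V ->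
  U ^+ 2 = Y + 2 * t * Z + t ^+ 2 * X -> V ^+ 2 = Y - 2 * t' * Z + t' ^+ 2 * X ->
  (1 + t) ^+ 2 <= 2 + 2 * U -> (1 + t') ^+ 2 <= 2 + 2 * V ->
  0 <= 1 - (1 - s ^+ 2) / (2 * s) ->
  (1 - (1 - s ^+ 2) / (2 * s)) ^+ 2 - Y / s ^+ 2 <= X.
Proof.
move=> s0 t0 t'0 tt U0 V0 UE VE hU hV G0; set G := 1 - _ in G0 *.
have P0 : 0 < t + t' by exact: addr_gt0.
(* Cauchy-Schwarz with the weights t' and t, for which the terms in [Z] cancel in t' U^2 + t V^2. *)
have cs : s ^+ 2 * (U + V) ^+ 2 <= (t + t') ^+ 2 * (Y + s ^+ 2 * X).
  have -> : (t + t') ^+ 2 * (Y + s ^+ 2 * X) = (t + t') * (t' * U ^+ 2 + t * V ^+ 2).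
    by rewrite UE VE -tt; ring.
  rewrite -tt -subr_ge0.
  rewrite (_ : _ - _ = (t' * U - t * V) ^+ 2) ?sqr_ge0//; ring.
have P2 : 2 * s <= t + t'.
  rewrite -ler_sqr ?nnegrE ?mulr_ge0 ?(ltW s0) ?(ltW P0)// exprMn -tt.
  by have := sqr_ge0 (t - t'); nra.
(* With P = t + t', the two bounds add up to U + V >= P^2 / 2 + P - 1 - s^2. Divided by P, the right
   side increases with P and equals [G] at P = 2 s, the least value allowed by [P2]. *)
have GP : G * (t + t') <= U + V.
  have : (t + t') ^+ 2 / 2 + (t + t') - 1 - s ^+ 2 <= U + V by rewrite -tt; nra.
  apply: le_trans; rewrite -subr_ge0.
  rewrite (_ : _ - _ = (t + t' - 2 * s) * ((t + t') / 2 + (1 + s ^+ 2) / (2 * s))).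
    apply: mulr_ge0; first by rewrite subr_ge0.
    by rewrite addr_ge0 ?divr_ge0 ?addr_ge0 ?sqr_ge0 ?mulr_ge0 ?(ltW s0) ?(ltW t0) ?(ltW t'0).
  by rewrite /G; field; rewrite lt0r_neq0.
have GP2 : (G * (t + t')) ^+ 2 <= (U + V) ^+ 2.
  rewrite ler_sqr// nnegrE; last exact: addr_ge0.
  by apply: mulr_ge0 => //; exact: ltW.
have s2 : 0 < s ^+ 2 by rewrite exprn_gt0.
have : s ^+ 2 * G ^+ 2 <= Y + s ^+ 2 * X.
  have PP : 0 < (t + t') ^+ 2 by rewrite exprn_gt0.
  rewrite -(ler_pM2l PP); apply: le_trans cs.
  by rewrite mulrCA -exprMn [(_ + _) * _]mulrC ler_pM2l.
rewrite lerBlDr -(ler_pM2l s2) => /le_trans; apply.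
rewrite mulrDr mulrCA divff ?mulr1; last by rewrite lt0r_neq0.
by rewrite addrC.
Qed.

(** * The problem scaled to p = 0 and local feature size 1 *)

Section ScaledManifold.
Context (R : realType) (d : nat).
Variables (S : set 'rV[R]_d) (T : 'rV[R]_d -> 'M[R]_d).
Implicit Types (b c m q u v w : 'rV[R]_d) (l r s t : R).

Hypothesis cS : compact S.
Hypothesis S0 : S 0.
(** This and [empty_balls] are the interface to geometry: smoothness enters as first-order
    approximation of tangent vectors, the local feature size as empty tangent balls. *)
Hypothesis tangent_approx : forall b v e, S b -> (v <= T b)%MS -> 0 < e ->
  exists2 s0 : R, 0 < s0 & forall s, 0 < s < s0 ->
    exists2 b', S b' & enorm (b' - b - s *: v) <= e * s.
Hypothesis empty_balls : forall b m t, S b -> (m <= orth (T b))%MS ->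
  enorm m = 1 -> 0 <= t -> enorm b < 1 -> enorm (b + t *: m) <= 1 ->
  forall b', S b' -> 2 * t * dot m (b' - b) <= dot (b' - b) (b' - b).

Let PT := proj (T 0).
Let PN := proj (orth (T 0)).

(** The unit ball tangent at 0 on the side of [PN b] is empty. *)
Lemma normal_part_le b : S b -> 2 * enorm (PN b) <= enorm b ^+ 2.
Proof.
move=> Sb; have [->|nb] := eqVneq (PN b) 0; first by rewrite enorm0 mulr0 sqr_ge0.
have [m m1 mE] := unit_vector nb.
have mN : (m <= orth (T 0))%MS.
  have <- : (enorm (PN b))^-1 *: PN b = m.
    by rewrite {2}mE scalerA mulVf ?scale1r// gt_eqF// enorm_gt0.
  by rewrite scalemx_sub// proj_sub.
have := empty_balls S0 mN m1 ler01 _ _ Sb.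
rewrite enorm0 add0r scale1r m1 lexx subr0 mulr1 => /(_ ltr01 isT).
by rewrite -sqr_enorm dotC -(dot_proj _ mN) -/(PN b) mE dotZl -sqr_enorm m1 expr1n mulr1
  enormZ m1 mulr1 ger0_norm ?enorm_ge0.
Qed.

Lemma tangent_step b v e s1 r : S b -> (v <= T b)%MS -> 0 < e -> 0 < s1 ->
    enorm b < r ->
  exists s b', [/\ 0 < s < s1, S b', enorm b' <= r &
    enorm (b' - b - s *: v) <= e * s].
Proof.
move=> Sb vT e0 s1gt br; have [s0 s0gt hs] := tangent_approx Sb vT e0.
pose D := enorm v + e; have D0 : 0 < D by rewrite ltr_wpDl ?enorm_ge0.
(* The displacement is at most [s * D], so the last bound keeps the new point within radius [r];
   halving makes the bounds strict. *)
pose s := Num.min (Num.min s0 s1) ((r - enorm b) / D) / 2.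
have m0 : 0 < Num.min (Num.min s0 s1) ((r - enorm b) / D).
  by rewrite !lt_min s0gt s1gt divr_gt0// subr_gt0.
have sgt : 0 < s by rewrite divr_gt0.
have slt : s < Num.min (Num.min s0 s1) ((r - enorm b) / D).
  by rewrite /s; lra.
move: slt; rewrite !lt_min => /andP[/andP[ss0 ss1] sD].
have [b' Sb' hb'] := hs s ltac:(by rewrite sgt).
exists s, b'; split=> //; first by rewrite sgt.
have -> : b' = b + (s *: v + (b' - b - s *: v)).
  by apply/rowP => i; rewrite !mxE; ring.
rewrite (le_trans (enormD _ _))// -lerBrDl.
rewrite (le_trans (enormD _ _))// enormZ gtr0_norm//.
rewrite ltr_pdivlMr// in sD; apply: ltW; apply: le_lt_trans sD.
by rewrite /D mulrDr [s * e]mulrC lerD2l.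
Qed.

(** Along a step s v the left side is of order s and the right side of order s^2, so dot m v <= 0;
    the same holds for -v. *)
Lemma normal_of_ball q m k : S q -> 0 < k ->
    (forall b', S b' -> k * dot m (b' - q) <= dot (b' - q) (b' - q)) ->
  (m <= orth (T q))%MS.
Proof.
move=> Sq k0 h.
have le0 v : (v <= T q)%MS -> dot m v <= 0.
  move=> vT; apply/ler_addgt0Pl => /= e e0; rewrite addr0.
  pose e1 := e / 2 / (enorm m + 1).
  have m1 : 0 < enorm m + 1 by rewrite ltr_wpDl ?enorm_ge0.
  have e10 : 0 < e1 by rewrite !divr_gt0.
  pose D := (enorm v + e1) ^+ 2 / k.
  have D0 : 0 < D by rewrite divr_gt0// exprn_gt0// ltr_wpDl ?enorm_ge0.
  have eD0 : 0 < e / 2 / D by apply: divr_gt0 => //; exact: divr_gt0.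
  have qlt : enorm q < enorm q + 1 by rewrite ltrDl.
  have [s [b' [/andP[s0 sD] Sb' _ hb']]] :=
    @tangent_step q v e1 (e / 2 / D) (enorm q + 1) Sq vT e10
      eD0 qlt.
  have [w wE] : exists w, w = b' - q - s *: v by exists (b' - q - s *: v).
  rewrite -wE in hb'.
  have bq : b' - q = s *: v + w by rewrite wE [RHS]addrC subrK.
  have := h _ Sb'; rewrite bq.
  have -> : dot m (s *: v + w) = s * dot m v + dot m w by rewrite dotDr dotZr.
  have n1 : dot (s *: v + w) (s *: v + w) <= (s * (enorm v + e1)) ^+ 2.
    rewrite -enorm_le; last by rewrite mulr_ge0 ?addr_ge0 ?enorm_ge0// ltW.
    by rewrite (le_trans (enormD _ _))// enormZ gtr0_norm// mulrDr lerD2l mulrC.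
  have n2 : - (enorm m * (e1 * s)) <= dot m w.
    have := normr_dot_le m w; rewrite ler_norml => /andP[+ _]; apply: le_trans.
    by rewrite lerN2 ler_wpM2l ?enorm_ge0.
  have n3 : enorm m * e1 <= e / 2.
    rewrite /e1 mulrCA ger_pMr ?divr_gt0// ler_pdivrMr// mul1r.
    by rewrite lerDl.
  move=> hk; have hk2 : k * (s * dot m v + dot m w) <= (s * (enorm v + e1)) ^+ 2.
    exact: le_trans hk n1.
  have kD : (s * (enorm v + e1)) ^+ 2 = k * (s ^+ 2 * D).
    by rewrite exprMn /D; field; rewrite lt0r_neq0.
  rewrite kD ler_pM2l// in hk2.
  have sD' : s * D <= e / 2 by rewrite -ler_pdivlMr// ltW.
  rewrite -(ler_pM2l s0).
  have : enorm m * e1 * s <= e / 2 * s by rewrite ler_pM2r.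
  have : s * (s * D) <= s * (e / 2) by rewrite ler_pM2l.
  clear -n2 hk2; move: (dot m v) (dot m w) n2 hk2 => mv mw n2 hk2; lra.
apply/orthP => v vT; apply/eqP; rewrite eq_le le0//= -oppr_le0 -dotNr.
by rewrite le0// eqmx_opp.
Qed.

(** Through [proj_surjective], this makes every vector of [T 0] the projection of a tangent vector
    at [b]. *)
Definition transverse b :=
  forall v, (v <= T 0)%MS -> (v <= orth (T b))%MS -> v = 0.

(* Maximise l - K |b_T - l c_T| for K large: at a maximum with |b| < r, moving
   along T b first forces b_T = l c_T and then l = L. *)
Lemma crossing c r L : 0 <= r -> 0 < L ->
    (forall b, S b -> enorm b < r -> transverse b) ->
  exists b l, [/\ S b, 0 <= l <= L, PT b = l *: PT c, enorm b <= r &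
    enorm b = r \/ l = L].
Proof.
move=> r0 L0 tr.
pose w (z : 'rV[R]_d * R^o) := PT z.1 - (z.2 : R) *: PT c.
have cfst : continuous (fst : 'rV[R]_d * R^o -> _) by move=> z; exact: cvg_fst.
have csnd : continuous (snd : 'rV[R]_d * R^o -> _) by move=> z; exact: cvg_snd.
have cw : continuous w.
  move=> z; apply: (@continuousB _ 'rV[R]_d _ (fun z => PT z.1)
     (fun z => (z.2 : R) *: PT c)).
    by apply: continuous_comp; [exact: cfst|exact: continuous_proj].
  exact: (@continuousZr_tmp _ 'rV[R]_d _ (fun z => z.2 : R) (PT c) z (csnd z)).
have cn := continuous_enorm_comp cw.
pose K := (S `&` [set b | enorm b <= r]) `*` `[0, L].
have KP b l : K (b, l) <-> [/\ S b, enorm b <= r & 0 <= l <= L].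
  by rewrite /K /= in_itv /=; split=> [[[]]|[]].
have cK : compact K.
  apply: compact_setX; last exact: segment_compact.
  apply: (subclosed_compact _ cS) => [|x []//]; apply: closedI.
    exact: closed_enorm.
  exact: closed_le_cst (@continuous_enorm _ _).
apply: contrapT => nex.
have wpos z : K z -> enorm z.1 = r -> 0 < enorm (w z).
  case: z => b l /KP[Sb br l01] /= brE; rewrite enorm_gt0; apply/negP => /eqP w0.
  apply: nex; exists b, l; split=> //; last by left.
  by apply/eqP; rewrite -subr_eq0 -w0.
(* On the sphere |b| = r, |w| has a positive minimum by compactness, so a large penalty [k] makes
   [f] negative there, whereas f (0, 0) = 0. *)
have [k k0 hk] : exists2 k, 0 < k &
    forall z, K z -> enorm z.1 = r -> L < k * enorm (w z).
  pose B := K `&` [set z | enorm z.1 = r].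
  have [B0|B0] := pselect (B !=set0); last first.
    by exists 1 => // z Kz zr; exfalso; apply: B0; exists z.
  have cB : compact B.
    apply: (subclosed_compact _ cK) => [|x []//]; apply: closedI.
      by apply: compact_closed cK; exact: norm_hausdorff.
    exact: closed_eq_cst (continuous_enorm_comp cfst).
  have [z0 z0B hz0] := compact_EVT_min B0 cB (continuous_subspaceT (A := B) cn).
  rewrite inE in z0B; have [Kz0 z0r] := z0B; have m0 := wpos _ Kz0 z0r.
  exists ((L + 1) / enorm (w z0)); first by rewrite divr_gt0// ltr_wpDl// ltW.
  move=> z Kz zr; have := hz0 z; rewrite inE => /(_ (conj Kz zr)) le1.
  rewrite mulrAC ltr_pdivlMr//.
  apply: (@lt_le_trans _ _ ((L + 1) * enorm (w z0))).
    by rewrite ltr_pM2r// ltrDl.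
  by rewrite ler_pM2l// ltr_wpDl// ltW.
pose f (z : 'rV[R]_d * R^o) : R := z.2 - k * enorm (w z).
have cf : continuous f.
  move=> z; apply: (@continuousB _ R^o _ snd (fun z => k * enorm (w z)) z (csnd z)).
  by apply: (@continuousM _ _ (fun=> k) _ z _ (cn z)); exact: cst_continuous.
have K00 : K (0, 0) by apply/KP; split; rewrite ?enorm0 ?lexx ?(ltW L0).
have [[b l] zK hz] :=
  compact_EVT_max (ex_intro _ _ K00) cK (continuous_subspaceT (A := K) cf).
rewrite inE in zK; have [Sb br /andP[l0 lL]] := (KP b l).1 zK.
have f0 : 0 <= f (b, l).
  have := hz (0, 0); rewrite inE => /(_ K00).
  by rewrite {1}/f /w /= /PT proj0 scale0r subrr enorm0 mulr0 subrr.
have br' : enorm b < r.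
  rewrite lt_neqAle br andbT; apply/negP => /eqP brE.
  have := hk _ zK brE; move: f0; rewrite /f /= => h1 h2.
  by clear -h1 h2 lL; lra.
have step v s b' e : enorm (b' - b - s *: v) <= e -> forall t,
    enorm (w (b', l + t)) <= enorm (w (b, l) + s *: PT v - t *: PT c) + e.
  move=> hb' t; have -> : w (b', l + t) =
      (w (b, l) + s *: PT v - t *: PT c) + PT (b' - b - s *: v).
    rewrite /w /PT !projB projZ /= scalerDl.
    by apply/rowP => i; rewrite !mxE; ring.
  by rewrite (le_trans (enormD _ _))// lerD2l (le_trans (enorm_proj _ _)).
have [w0|w0] := eqVneq (w (b, l)) 0.
  have lL' : l != L.
    apply/eqP => lE; apply: nex; exists b, l; split=> //.
    - by rewrite l0.
    - by apply/eqP; rewrite -subr_eq0 -w0.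
    - by right.
  have {}lL : 0 < L - l by rewrite subr_gt0 lt_neqAle lL'.
  (* Moving along [v] while raising [l] by [s] keeps [w] at 0 up to s / (2 k), so [f] gains at least
     s / 2. *)
  have [v vT Pv] := proj_surjective (tr b Sb br') (proj_sub (T 0) c).
  have [s [b' [/andP[s0 sL] Sb' b'r hb']]] :=
    @tangent_step b v (1 / (2 * k)) (L - l) r Sb vT
      ltac:(by rewrite divr_gt0// mulr_gt0) lL br'.
  have Kb' : K (b', l + s).
    by apply/KP; split=> //; rewrite addr_ge0 ?(ltW s0)//= -lerBrDl ltW.
  have := hz (b', l + s); rewrite inE => /(_ Kb'); rewrite /f /= w0 enorm0.
  have := step _ _ _ _ hb' s; rewrite w0 add0r [PT v]Pv subrr enorm0 add0r.
  rewrite -(ler_pM2l k0) (_ : k * (1 / (2 * k) * s) = s / 2); last first.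
    by field; rewrite lt0r_neq0.
  clear -s0; lra.
have nw : 0 < enorm (w (b, l)) by rewrite enorm_gt0.
have wT : (w (b, l) <= T 0)%MS.
  by rewrite /w addmx_sub ?proj_sub// eqmx_opp scalemx_sub// proj_sub.
(* Keeping [l] and moving [b] against the unit vector of [w] lowers |w| by at least s / 2. *)
have [v vT Pv] := proj_surjective (tr b Sb br')
  (scalemx_sub (- (enorm (w (b, l)))^-1) wT).
have [s [b' [/andP[s0 sL] Sb' b'r hb']]] :=
  @tangent_step b v (1 / 2) (enorm (w (b, l))) r Sb vT ltac:(by []) nw br'.
have Kb' : K (b', l) by apply/KP; rewrite l0 lL.
have := hz (b', l); rewrite inE => /(_ Kb'); rewrite /f /=.
have := step _ _ _ _ hb' 0; rewrite addr0 scale0r subr0 [PT v]Pv.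
have -> : w (b, l) + s *: (- (enorm (w (b, l)))^-1 *: w (b, l)) =
    (1 - s / enorm (w (b, l))) *: w (b, l).
  by rewrite scalerA scalerBl scale1r mulrN scaleNr.
rewrite enormZ ger0_norm; last first.
  by rewrite subr_ge0 ler_pdivrMr// mul1r ltW.
rewrite mulrBl mul1r divfK ?gt_eqF// -(ler_pM2l k0).
by have := mulr_gt0 k0 s0; lra.
Qed.

(** Only the tangent parts of [b] and [c] are aligned; the difference of the normal parts is bounded
    by the triangle inequality, whence a + y. *)
Lemma crossing_coordinates c b l : S b -> enorm c = 1 -> PT b = l *: PT c ->
    enorm b < 1 ->
  let a := enorm (PN c) in let y := enorm (PN b) in
  [/\ 0 <= a <= 1, 0 <= y < 1, 2 * y <= l ^+ 2 * (1 - a ^+ 2) + y ^+ 2,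
    enorm b ^+ 2 = l ^+ 2 * (1 - a ^+ 2) + y ^+ 2 &
    enorm (c - b) ^+ 2 <= (1 - l) ^+ 2 * (1 - a ^+ 2) + (a + y) ^+ 2].
Proof.
move=> Sb c1 bl b1 a y.
have cT : enorm (PT c) ^+ 2 = 1 - a ^+ 2.
  by apply/eqP; rewrite eq_sym subr_eq -proj_pythagoras c1 expr1n.
have bE : enorm b ^+ 2 = l ^+ 2 * (1 - a ^+ 2) + y ^+ 2.
  rewrite (proj_pythagoras (T 0)) -/PT -/PN bl enormZ exprMn cT.
  by rewrite real_normK ?num_real.
split=> //.
- by rewrite enorm_ge0 -c1 enorm_proj.
- by rewrite enorm_ge0 (le_lt_trans (enorm_proj _ _)).
- by rewrite -bE normal_part_le.
rewrite (proj_pythagoras (T 0)) -/PT -/PN /PT /PN !projB -/PT -/PN bl.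
rewrite -{1}[PT c]scale1r -scalerBl enormZ exprMn cT real_normK ?num_real//.
rewrite lerD2l ler_sqr ?nnegrE ?enorm_ge0 ?addr_ge0 ?enorm_ge0//.
by rewrite (le_trans (enormD _ _))// enormN.
Qed.

Lemma empty_ball_dist q m t b : S q -> (m <= orth (T q))%MS -> enorm m = 1 ->
    0 <= t -> enorm q < 1 -> enorm (q + t *: m) <= 1 -> S b ->
  t <= enorm (q + t *: m - b).
Proof.
move=> Sq mN m1 t0 q1 qt Sb; have := empty_balls Sq mN m1 t0 q1 qt Sb.
rewrite enorm_ge// (_ : q + t *: m - b = t *: m - (b - q)); last first.
  by apply/rowP => i; rewrite !mxE; ring.
move: (b - q) => w; rewrite !dotE (dotC w m) -(sqr_enorm m) m1; lra.
Qed.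

Lemma crossing_ratio c : enorm c = 1 ->
  exists r, [/\ 1 < r, r ^+ 2 = 2 + 2 * enorm (PN c) & 0 < 1 / r].
Proof.
move=> c1; have a0 := enorm_ge0 (PN c).
have pos : 0 <= 2 + 2 * enorm (PN c) by lra.
exists (Num.sqrt (2 + 2 * enorm (PN c))); rewrite sqr_sqrtr//; split=> //.
  by rewrite -[X in X < _]sqrtr1 ltr_sqrt; lra.
by rewrite divr_gt0// sqrtr_gt0; lra.
Qed.

(* Take a degenerate pair (q, m) with |q| minimal: by minimality the crossing
   lemma applies up to radius |q|, and the point it gives lies in the empty
   ball tangent to S at q in direction m. *)
Lemma transverse_near b : S b -> enorm b ^+ 4 + enorm b ^+ 2 < 1 -> transverse b.
Proof.
move=> Sb1 hb1 v vT vN; apply/eqP/negP => /negP v0.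
set r1 := enorm b in hb1; have r10 : 0 <= r1 by exact: enorm_ge0.
have r1lt : r1 < 1.
  rewrite -(@expr_lt1 _ 2)//; have : 0 <= r1 ^+ 4 by rewrite exprn_ge0.
  lra.
set k := 1 - r1; have k0 : 0 < k by rewrite subr_gt0.
(* Normality of [z.2] at [z.1] is encoded by an empty ball of fixed radius [k], a closed condition
   that asks for no continuity of [T]; [normal_of_ball] recovers normality. *)
pose D := [set z : 'rV[R]_d * 'rV[R]_d | [/\ S z.1, enorm z.1 <= r1, enorm z.2 = 1,
  (z.2 <= T 0)%MS & forall b', S b' ->
    2 * k * dot z.2 (b' - z.1) <= dot (b' - z.1) (b' - z.1)]].
have cfst : continuous (fst : 'rV[R]_d * 'rV[R]_d -> _) by move=> z; exact: cvg_fst.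
have csnd : continuous (snd : 'rV[R]_d * 'rV[R]_d -> _) by move=> z; exact: cvg_snd.
pose gap (b' : 'rV[R]_d) (z : 'rV[R]_d * 'rV[R]_d) : R :=
  dot (b' - z.1) (b' - z.1) - 2 * k * dot z.2 (b' - z.1).
have cgap (b' : 'rV[R]_d) : continuous (gap b').
  have cb : continuous (fun z : 'rV[R]_d * 'rV[R]_d => b' - z.1 : 'rV[R]_d).
    by move=> z; exact: (@continuousB _ 'rV[R]_d _ (fun=> b') fst z
      (@cst_continuous _ _ b' z) (cfst z)).
  have c1 := continuous_dot cb cb.
  have c2 := continuous_dot csnd cb.
  have c3 z : {for z, continuous (fun z : 'rV[R]_d * 'rV[R]_d =>
      2 * k * dot z.2 (b' - z.1))}.
    apply: (@continuousM _ _ (fun=> 2 * k) _ z _ (c2 z)).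
    exact: cst_continuous.
  by move=> z; exact: (@continuousB _ R^o _ _ _ z (c1 z) (c3 z)).
have cD : compact D.
  have cSS : compact (S `*` [set m : 'rV[R]_d | enorm m = 1]).
    apply: compact_setX => //; apply: (@compact_enorm_closed _ _ _ 1).
      exact: closed_eq_cst (@continuous_enorm _ _).
    by move=> x /= ->.
  have -> : D = (S `*` [set m : 'rV[R]_d | enorm m = 1]) `&`
     ([set z | enorm z.1 <= r1] `&` [set z | enorm (PN z.2) <= 0] `&`
      \bigcap_(b' in S) [set z | 0 <= gap b' z]).
    apply/seteqP; split=> [[x y] [/= Sx xr y1 yT h]|[x y] [[/= Sx y1] [[/= xr yN] h]]].
      split=> //; split; last by move=> b' Sb' /=; rewrite subr_ge0 h.
      by split=> //=; rewrite /PN projC proj_id// subrr enorm0.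
    split=> //=; last by move=> b' Sb'; rewrite -subr_ge0; exact: h.
    have /eqP : enorm (PN y) = 0 by apply/eqP; rewrite eq_le yN enorm_ge0.
    by rewrite enorm_eq0 /PN projC subr_eq0 => /eqP ->; exact: proj_sub.
  apply: (subclosed_compact _ cSS); last by move=> z [].
  apply: closedI; first by apply: compact_closed cSS; exact: norm_hausdorff.
  apply: closedI; first apply: closedI.
  - exact: closed_le_cst (continuous_enorm_comp cfst).
  - apply: closed_le_cst; apply: continuous_enorm_comp => z.
    by apply: continuous_comp; [exact: csnd|exact: continuous_proj].
  by apply: closed_bigI => b' _; exact: closed_ge_cst.
have memD x m : S x -> enorm x <= r1 -> enorm m = 1 -> (m <= T 0)%MS ->
    (m <= orth (T x))%MS -> D (x, m).
  move=> Sx xr m1 mT mN; split=> //= b' Sb'.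
  apply: empty_balls => //; first exact: ltW.
    exact: le_lt_trans r1lt.
  rewrite (le_trans (enormD _ _))// enormZ m1 mulr1 ger0_norm ?(ltW k0)//.
  by rewrite /k; lra.
have memDv x u : S x -> enorm x <= r1 -> u != 0 -> (u <= T 0)%MS ->
    (u <= orth (T x))%MS -> exists m, D (x, m).
  move=> Sx xr u0 uT uN; have [m m1 mE] := unit_vector u0.
  have mu : m = (enorm u)^-1 *: u.
    by rewrite {2}mE scalerA mulVf ?scale1r// gt_eqF// enorm_gt0.
  by exists m; apply: memD => //; rewrite mu scalemx_sub.
have D0 : D !=set0.
  by have [m Dm] := memDv b v Sb1 (lexx _) v0 vT vN; exists (b, m).
have [[q m] zD hmin] := compact_EVT_min D0 cD
  (continuous_subspaceT (A := D) (continuous_enorm_comp cfst)).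
rewrite inE in zD; have [/= Sq qr m1 mT hm] := zD.
have mN : (m <= orth (T q))%MS.
  by apply: (normal_of_ball Sq _ hm); rewrite mulr_gt0.
set r := enorm q in qr.
have tr x : S x -> enorm x < r -> transverse x.
  move=> Sx xr u uT uN; apply/eqP/negP => /negP u0.
  have [m' Dm'] := memDv x u Sx (ltW (lt_le_trans xr qr)) u0 uT uN.
  by have := hmin (x, m'); rewrite inE => /(_ Dm') /=; rewrite leNgt xr.
have q0 : 0 < r.
  rewrite enorm_gt0; apply/eqP => q0; rewrite q0 in mN.
  have := dot_orth mN mT; rewrite -sqr_enorm m1 expr1n => /eqP.
  by rewrite oner_eq0.
have r_lt1 : r < 1 by exact: le_lt_trans r1lt.
have hr : r ^+ 4 + r ^+ 2 < 1.
  apply: le_lt_trans hb1; apply: lerD; apply: lerXn2r => //; exact: ltW.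
(* With this sign [t] is the larger of the two distances from [q] to the unit sphere along the line
   through [m], so t^2 >= 1 - r^2. *)
wlog qm : m m1 mT mN {zD hm hmin} / dot q m <= 0.
  move=> H; have [qm|qm] := leP (dot q m) 0; first exact: (H m).
  by apply: (H (- m)); rewrite ?enormN ?eqmx_opp// dotNr oppr_le0 ltW.
pose disc := dot q m ^+ 2 + (1 - r ^+ 2).
have r2 : r ^+ 2 < 1 by rewrite expr_lt1 ?(ltW q0).
have disc0 : 0 <= disc by rewrite addr_ge0 ?sqr_ge0// subr_ge0 ltW.
pose t := - dot q m + Num.sqrt disc.
have t0 : 0 <= t by rewrite addr_ge0 ?oppr_ge0// sqrtr_ge0.
have sq := sqr_sqrtr disc0; have sq0 := sqrtr_ge0 disc.
have mm : dot m m = 1 by rewrite -sqr_enorm m1 expr1n.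
have c1 : enorm (q + t *: m) = 1.
  apply/eqP; rewrite -(@eqrXn2 _ 2) ?enorm_ge0// sqr_enorm !dotE (dotC m q).
  rewrite mm -sqr_enorm -/r expr1n; apply/eqP.
  by rewrite /t; move: sq; rewrite /disc; lra.
have t2 : 1 - r ^+ 2 <= t ^+ 2.
  rewrite /t; move: sq; rewrite {2}/disc => sq2.
  by have := mulr_ge0 (ltac:(by rewrite oppr_ge0) : 0 <= - dot q m) sq0; nra.
set c := q + t *: m in c1.
(* [m] is tangent at 0, so [c] and [q] have the same normal part. *)
have cN : enorm (PN c) <= r ^+ 2 / 2.
  rewrite /c /PN projD projZ (projC (T 0) m) (proj_id mT) subrr scaler0 addr0.
  by have := normal_part_le Sq; rewrite -/r -/PN; lra.
have [s [s1 sE s0]] := crossing_ratio c1.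
have sgt : 0 < s by lra.
have [x [l [Sx /andP[l0 ls] xl xr or]]] := crossing c (ltW q0) s0 tr.
have x1 : enorm x < 1 by exact: le_lt_trans r_lt1.
have [a01 y01 y2 xE cx] := crossing_coordinates Sx c1 xl x1.
have tx : t <= enorm (c - x) by apply: empty_ball_dist => //; rewrite c1.
have tx2 : t ^+ 2 <= enorm (c - x) ^+ 2.
  by rewrite ler_sqr ?nnegrE ?enorm_ge0.
(* If the crossing stops at |x| = r, [crossing_partial] puts [x] strictly inside the empty ball at
   [q]. *)
case: or => [xr'|lE].
  have ls1 : l * s <= 1 by rewrite -ler_pdivlMr.
  have := crossing_partial a01 sgt sE l0 ls1 y01 y2.
  rewrite -xE xr' exprn_gt0// => /(_ isT) h1; clear -h1 t2 tx2 cx; lra.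
have ls1 : l * s = 1 by rewrite lE divfK// gt_eqF.
have := crossing_full a01 sgt sE ls1 y01 y2 => h.
have ts : t <= s - 1.
  by rewrite -ler_sqr ?nnegrE ?subr_ge0 ?(ltW s1)// (le_trans tx2)// (le_trans cx).
have ts2 : (1 + t) ^+ 2 <= 2 + r ^+ 2.
  apply: (@le_trans _ _ (s ^+ 2)).
    have ts1 : 1 + t <= s by rewrite addrC -lerBrDr.
    have t10 : 0 <= 1 + t by apply: addr_ge0.
    by rewrite ler_sqr ?nnegrE ?t10 ?(ltW sgt).
  by rewrite sE; clear -cN; lra.
have tr2 : t <= r ^+ 2.
  by rewrite sqrrD expr1n in ts2; clear -ts2 t2; lra.
have : t ^+ 2 <= (r ^+ 2) ^+ 2 by rewrite ler_sqr ?nnegrE ?sqr_ge0.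
by rewrite -exprM => h2; clear -h2 t2 hr; lra.
Qed.

(* The radius sqrt (3/5) only needs to satisfy 2 - sqrt 2 < r^2 and
   r^4 + r^2 < 1. *)
Lemma empty_ball_radius q m t : S q -> enorm q < 1 -> (m <= orth (T q))%MS ->
    enorm m = 1 -> 0 <= t -> enorm (q + t *: m) = 1 ->
  (1 + t) ^+ 2 <= 2 + 2 * enorm (PN (q + t *: m)).
Proof.
move=> Sq q1 mN m1 t0 c1; set c := q + t *: m in c1 *.
have [s [s1 sE s0]] := crossing_ratio c1.
have sgt : 0 < s by lra.
pose r : R := Num.sqrt (3 / 5).
have rE : r ^+ 2 = 3 / 5 by rewrite sqr_sqrtr.
have r0 : 0 <= r by exact: sqrtr_ge0.
have r1 : r < 1 by rewrite -(@expr_lt1 _ 2)// rE; lra.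
have tr x : S x -> enorm x < r -> transverse x.
  move=> Sx xr; apply: transverse_near => //.
  have h : enorm x ^+ 2 < 3 / 5 by rewrite -rE ltr_sqr ?nnegrE ?enorm_ge0.
  by rewrite (_ : enorm x ^+ 4 = (enorm x ^+ 2) ^+ 2) -?exprM//; have := sqr_ge0 (enorm x); nra.
have [x [l [Sx /andP[l0 ls] xl xr or]]] := crossing c r0 s0 tr.
have x1 : enorm x < 1 by exact: le_lt_trans r1.
have [a01 y01 y2 xE cx] := crossing_coordinates Sx c1 xl x1.
case: or => [xr'|lE].
  have ls1 : l * s <= 1 by rewrite -ler_pdivlMr.
  have := crossing_partial_radius a01 sgt sE l0 ls1 y01 y2.
  by rewrite -xE xr' rE; have := enorm_ge0 (PN c); nra.
have ls1 : l * s = 1 by rewrite lE divfK// gt_eqF.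
have h := crossing_full a01 sgt sE ls1 y01 y2.
have tx : t <= enorm (c - x) by apply: empty_ball_dist => //; rewrite c1.
have ts : t <= s - 1.
  rewrite (le_trans tx)// -ler_sqr ?nnegrE ?enorm_ge0 ?subr_ge0 ?(ltW s1)//.
  exact: le_trans h.
by rewrite -sE ler_sqr ?nnegrE ?addr_ge0 ?(ltW sgt)//; lra.
Qed.

Lemma normal_angle_bound q m : S q -> enorm q ^+ 4 + enorm q ^+ 2 < 1 ->
    (m <= orth (T q))%MS -> enorm m = 1 ->
  (1 - enorm q ^+ 2 / (2 * Num.sqrt (1 - enorm q ^+ 2))) ^+ 2
    - enorm (PN q) ^+ 2 / (1 - enorm q ^+ 2) <= enorm (PN m) ^+ 2.
Proof.
move=> Sq; set r := enorm q => hr mN m1.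
have r0 : 0 <= r by exact: enorm_ge0.
have r2 : r ^+ 2 < 1 by have : 0 <= r ^+ 4 by [exact: exprn_ge0]; lra.
have q1 : r < 1 by rewrite -(@expr_lt1 _ 2).
set s := Num.sqrt _.
have s2 : s ^+ 2 = 1 - r ^+ 2 by rewrite sqr_sqrtr// subr_ge0 ltW.
have s0 : 0 < s by rewrite sqrtr_gt0 subr_gt0.
have rs : r ^+ 2 = 1 - s ^+ 2 by rewrite s2; ring.
pose disc := dot q m ^+ 2 + s ^+ 2.
have disc0 : 0 <= disc by rewrite addr_ge0 ?sqr_ge0.
have sq := sqr_sqrtr disc0; have sq0 := sqrtr_ge0 disc.
have s2pos : 0 < s ^+ 2 by rewrite exprn_gt0.
have absle : `|dot q m| < Num.sqrt disc.
  rewrite -ltr_sqr ?nnegrE// sq real_normK ?num_real// /disc; lra.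
move: absle; rewrite ltr_norml => /andP[lo hi].
have mm : dot m m = 1 by rewrite -sqr_enorm m1 expr1n.
(* Distances from [q] to the unit sphere in the directions m and -m; their product is, up to sign,
   the power of [q] with respect to the sphere. *)
pose t := Num.sqrt disc - dot q m; pose t' := Num.sqrt disc + dot q m.
have t0 : 0 < t by rewrite subr_gt0.
have t'0 : 0 < t' by rewrite /t'; lra.
have tt : t * t' = s ^+ 2 by move: sq; rewrite /t /t' /disc; lra.
have c1 : enorm (q + t *: m) = 1.
  apply/eqP; rewrite -(@eqrXn2 _ 2) ?enorm_ge0// sqr_enorm !dotE (dotC m q).
  rewrite mm -sqr_enorm -/r expr1n rs; apply/eqP.
  by rewrite /t; move: sq; rewrite /disc; lra.
have c1' : enorm (q + t' *: - m) = 1.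
  apply/eqP; rewrite -(@eqrXn2 _ 2) ?enorm_ge0// sqr_enorm !dotE (dotC m q).
  rewrite mm -sqr_enorm -/r expr1n rs; apply/eqP.
  by rewrite /t'; move: sq; rewrite /disc; lra.
have hU := empty_ball_radius Sq q1 mN m1 (ltW t0) c1.
have hV : (1 + t') ^+ 2 <= 2 + 2 * enorm (PN (q + t' *: - m)).
  by apply: empty_ball_radius => //; rewrite ?eqmx_opp ?enormN// ltW.
have pe z : PN (q + z *: m) = PN q + z *: PN m by rewrite /PN projD projZ.
rewrite rs in hr *.
have ps2 : s ^+ 2 = 1 - (1 - s ^+ 2) by ring.
rewrite -ps2; apply: (two_sided_bound (Z := dot (PN q) (PN m)) s0 t0 t'0 tt _ _ _ _ hU hV).
- exact: enorm_ge0.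
- exact: enorm_ge0.
- rewrite pe; move: (PN q) (PN m) => u w.
  by rewrite !sqr_enorm !dotE (dotC w u); ring.
- rewrite scalerN -scaleNr pe; move: (PN q) (PN m) => u w.
  by rewrite !sqr_enorm !dotE (dotC w u); ring.
rewrite subr_ge0 ler_pdivrMr ?mulr_gt0// mul1r.
(* The condition r^4 + r^2 < 1 rewritten in terms of [s]. *)
have : (1 - s ^+ 2) < s.
  rewrite -ltr_sqr ?nnegrE ?(ltW s0)//; last by rewrite -rs sqr_ge0.
  have : r ^+ 4 = (r ^+ 2) ^+ 2 by rewrite -exprM.
  by move=> E; move: hr; rewrite E rs; lra.
lra.
Qed.

End ScaledManifold.

(** * Second-order calculus *)

Lemma enorm_convex_lt (R : realType) d (u v : 'rV[R]_d) (r t : R) :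
  enorm u < r -> enorm v < r -> 0 <= t <= 1 ->
  enorm (t *: u + (1 - t) *: v) < r.
Proof.
move=> ur vr /andP[t0 t1].
apply: (@le_lt_trans _ _ (Num.max (enorm u) (enorm v))); last by rewrite gt_max ur.
have um : enorm u <= Num.max (enorm u) (enorm v) by rewrite le_max lexx.
have vm : enorm v <= Num.max (enorm u) (enorm v) by rewrite le_max lexx orbT.
apply: (le_trans (enormD _ _)); rewrite !enormZ !ger0_norm ?subr_ge0//.
have := ler_wpM2l t0 um; have := ler_wpM2l (ltac:(by rewrite subr_ge0) : 0 <= 1 - t) vm.
lra.
Qed.

Section VectorCalculus.
Context (R : realType) (d e : nat).
Implicit Types (f : 'rV[R]_d -> 'rV[R]_e) (x y v w p : 'rV[R]_d) (n : 'rV[R]_e).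

Lemma is_derive_line (W : normedModType R) (f : 'rV[R]_d -> W) x v (t : R^o) :
    derivable f (x + (t : R) *: v) v ->
  is_derive t (1 : R^o) (fun s : R^o => f (x + (s : R) *: v)) ('D_v f (x + (t : R) *: v)).
Proof.
move=> df; have E : (fun h : R^o => h^-1 *:
      (((fun s : R^o => f (x + (s : R) *: v)) \o shift t) (h *: (1 : R^o)) -
        f (x + (t : R) *: v))) =
    (fun h : R => h^-1 *: ((f \o shift (x + t *: v)) (h *: v) - f (x + t *: v))).
  apply/funext => h /=; congr (_ *: (f _ - _)).
  by rewrite /shift /= addrCA -scalerDl; congr (_ + _ *: _); rewrite /GRing.scale /= mulr1.
by split; rewrite /derivable /derive E.
Qed.

Lemma is_derive_dot (V : normedModType R) (g : V -> 'rV[R]_e) (a b : V) n :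
    derivable g a b ->
  is_derive a b (fun s => dot (g s) n : R^o) (dot ('D_b g a) n).
Proof.
move=> dg.
have E : (fun h : R => h^-1 *: (((fun s => dot (g s) n : R^o) \o shift a) (h *: b)
      - (dot (g a) n : R^o))) =
    (fun h : R => dot (h^-1 *: ((g \o shift a) (h *: b) - g a)) n : R^o).
  by apply/funext => h /=; rewrite !dotE.
have C : dot (h^-1 *: ((g \o shift a) (h *: b) - g a)) n @[h --> 0^'] --> dot ('D_b g a) n.
  exact: (cvg_comp _ _ dg (@continuous_dotr _ _ n _)).
split; last by rewrite /derive E; exact: (cvg_lim (@norm_hausdorff _ _) C).
by rewrite /derivable E; apply: cvgP C.
Qed.

(** Pairing with a fixed [n] restores the mean value theorem, which fails for vector values. *)
Lemma mean_value_dot f x v n :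
    (forall t, 0 <= t <= 1 -> derivable f (x + t *: v) v) ->
  exists2 t, 0 < t < 1 & dot (f (x + v) - f x) n = dot ('D_v f (x + t *: v)) n.
Proof.
move=> df; pose g (s : R^o) : R^o := dot (f (x + (s : R) *: v)) n.
have dg (t : R) : 0 <= t <= 1 ->
    is_derive (t : R^o) (1 : R^o) g (dot ('D_v f (x + t *: v)) n).
  move=> t01; have := is_derive_line (df t t01) => -[ex val].
  by have := is_derive_dot n ex; rewrite val.
have [||t] := @MVT R g (fun t => dot ('D_v f (x + t *: v)) n) 0 1 ltr01.
- by move=> t; rewrite in_itv /= => /andP[t0 t1]; apply: dg; rewrite !ltW.
- apply: continuous_in_subspaceT => t; rewrite inE /= in_itv /= => /dg[ex _].
  by apply: differentiable_continuous; exact/derivable1_diffP.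
rewrite in_itv /= /g scale1r scale0r addr0 subr0 mulr1 => t01 E.
by exists t => //; rewrite -E -dotNl -dotDl.
Qed.

Lemma derive_sum_delta f x v : differentiable f x ->
  'D_v f x = \sum_(j < d) v 0 j *: 'D_('e_j) f x.
Proof.
move=> df; rewrite deriveE// {1}(row_sum_delta v) raddf_sum.
by apply: eq_bigr => j _; rewrite deriveE//; exact: linearZZ.
Qed.

(** The mean value theorem is applied with n = f x - f y, and one factor |f x - f y| is
    cancelled. *)
Lemma C1_lipschitz f U p : open U -> U p -> Ck_on 1 U f ->
  exists r C, [/\ 0 < r, 0 <= C, forall x, enorm (x - p) < r -> U x &
    forall x y, enorm (x - p) < r -> enorm (y - p) < r ->
      enorm (f x - f y) <= C * enorm (x - y)].
Proof.
move=> oU Up [df cf].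
have [r0 r0gt rU] := (nbhs_enormP _ _).1 (open_nbhs_nbhs (conj oU Up)).
have : \forall x \near p, forall j : 'I_d,
    enorm ('D_('e_j) f x) < enorm ('D_('e_j) f p) + 1.
  apply: (@filter_forall _ _ (fun (j : 'I_d) x =>
    enorm ('D_('e_j) f x) < enorm ('D_('e_j) f p) + 1) (nbhs p)) => j.
  have c : {for p, continuous (fun x => enorm ('D_('e_j) f x))}.
    by apply: continuous_comp; [exact: cf|exact: continuous_enorm].
  by apply: (cvgr_lt _ c); rewrite ltrDl.
move=> /nbhs_enormP[r1 r1gt hr1].
(* [Ck_on] gives continuity of each directional derivative separately, so the bound is assembled
   from the coordinate directions. *)
pose C := \sum_(j < d) (enorm ('D_('e_j) f p) + 1).
have C0 : 0 <= C by apply: sumr_ge0 => j _; rewrite addr_ge0 ?enorm_ge0.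
exists (Num.min r0 r1), C; split=> //.
- by rewrite lt_min r0gt.
- by move=> x; rewrite lt_min => /andP[/rU].
move=> x y; rewrite !lt_min => /andP[xr0 xr1] /andP[yr0 yr1].
have [-> |fxy] := eqVneq (f x - f y) 0.
  by rewrite enorm0 mulr_ge0 ?enorm_ge0.
pose z t := y + t *: (x - y).
have zr r t : enorm (x - p) < r -> enorm (y - p) < r -> 0 <= t <= 1 ->
    enorm (z t - p) < r.
  move=> xr yr t01.
  have -> : z t - p = t *: (x - p) + (1 - t) *: (y - p).
    by apply/rowP => i; rewrite !mxE; ring.
  exact: enorm_convex_lt.
have [|t t01 E] := @mean_value_dot f y (x - y) (f x - f y).
  by move=> t t01; apply: diff_derivable; apply: df; apply: rU; exact: zr.
rewrite [y + (x - y)]addrC subrK -sqr_enorm in E.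
have t01' : 0 <= t <= 1 by case/andP: t01 => ? ?; rewrite !ltW.
have dz : differentiable f (z t) by apply: df; apply: rU; exact: zr.
have bD : enorm ('D_(x - y) f (z t)) <= C * enorm (x - y).
  rewrite derive_sum_delta// /C mulr_suml.
  elim/big_ind2 : _ => [|u1 u2 v1 v2 h1 h2|j _].
  - by rewrite enorm0.
  - by rewrite (le_trans (enormD _ _))// lerD.
  rewrite enormZ mulrC; apply: ler_pM; rewrite ?enorm_ge0//.
    by apply: ltW; apply: hr1; exact: zr.
  exact: coord_le_enorm.
have np : 0 < enorm (f x - f y) by rewrite enorm_gt0.
rewrite -(ler_pM2r np) -expr2 E (le_trans (dot_le _ _))//.
by rewrite ler_wpM2r ?enorm_ge0.
Qed.

(** The derivative at an intermediate point differs from the one at [x] by O(|y - x|), since the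
    partial derivatives are Lipschitz. The constant is uniform in [x] and [y], as the base point
    will vary over [S]. *)
Lemma C2_taylor f U p : open U -> U p -> Ck_on 2 U f ->
  exists r C, [/\ 0 < r, 0 <= C, forall x, enorm (x - p) < r -> U x &
    forall x y n, enorm (x - p) < r -> enorm (y - p) < r ->
      dot ('D_(y - x) f x) n = 0 ->
      dot (f y - f x) n <= C * enorm n * enorm (y - x) ^+ 2].
Proof.
move=> oU Up [df cf].
have [r0 r0gt rU] := (nbhs_enormP _ _).1 (open_nbhs_nbhs (conj oU Up)).
have /choice[rC hrC] : forall j : 'I_d, exists rC : R * R, [/\ 0 < rC.1, 0 <= rC.2 &
    forall x y, enorm (x - p) < rC.1 -> enorm (y - p) < rC.1 ->
      enorm ('D_('e_j) f x - 'D_('e_j) f y) <= rC.2 * enorm (x - y)].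
  by move=> j; have [r [C [? ? _ ?]]] := C1_lipschitz oU Up (cf 'e_j); exists (r, C).
pose r := \big[Num.min/r0]_(j < d) (rC j).1.
have rgt : 0 < r.
  by rewrite /r; elim/big_ind : _ => // [a b a0 b0|j _]; [rewrite lt_min a0|case: (hrC j)].
have rle0 : r <= r0 by exact: bigmin_le_id.
have rle j : r <= (rC j).1 by exact: bigmin_le.
pose C := \sum_(j < d) (rC j).2.
have C0 : 0 <= C by apply: sumr_ge0 => j _; case: (hrC j).
exists r, C; split=> //; first by move=> x xr; apply: rU; exact: lt_le_trans rle0.
move=> x y n xr yr xn.
pose z t := x + t *: (y - x).
have zr t : 0 <= t <= 1 -> enorm (z t - p) < r.
  move=> t01.
  have -> : z t - p = t *: (y - p) + (1 - t) *: (x - p).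
    by apply/rowP => i; rewrite !mxE; ring.
  exact: enorm_convex_lt.
have [|t t01 E] := @mean_value_dot f x (y - x) n.
  move=> t t01; apply: diff_derivable; apply: df; apply: rU.
  by apply: lt_le_trans rle0; exact: zr.
rewrite [x + (y - x)]addrC subrK in E; have [t0 t1] := andP t01.
have t01' : 0 <= t <= 1 by rewrite !ltW.
have diffz s : 0 <= s <= 1 -> differentiable f (z s).
  by move=> s01; apply: df; apply: rU; apply: lt_le_trans rle0; exact: zr.
have dz := diffz _ t01'; have dx : differentiable f x.
  by apply: df; apply: rU; apply: lt_le_trans rle0.
have bD : enorm ('D_(y - x) f (z t) - 'D_(y - x) f x) <= C * enorm (y - x) ^+ 2.
  rewrite !derive_sum_delta// -sumrB /C mulr_suml.
  elim/big_ind2 : _ => [|u1 u2 v1 v2 h1 h2|j _].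
  - by rewrite enorm0.
  - by rewrite (le_trans (enormD _ _))// lerD.
  have [rj0 Cj0 hj] := hrC j.
  rewrite -scalerBr enormZ expr2 mulrCA.
  apply: ler_pM; rewrite ?enorm_ge0// ?coord_le_enorm//.
  apply: (le_trans (hj _ _ _ _)); try by apply: lt_le_trans (rle j); rewrite // zr.
  apply: ler_wpM2l => //; rewrite /z addrAC subrr add0r enormZ gtr0_norm//.
  by rewrite ler_piMl ?enorm_ge0// ltW.
rewrite E -[dot _ _]subr0 -xn -dotNl -dotDl (le_trans (dot_le _ _))//.
by rewrite mulrAC ler_wpM2r ?enorm_ge0.
Qed.

Lemma Ck_on_line f U x v (I : set R^o) k : open I ->
    (forall t, I t -> U (x + (t : R) *: v)) -> Ck_on k U f ->
  Ck_on k I (fun t : R^o => f (x + (t : R) *: v)).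
Proof.
move=> oI IU cf.
(* The scalar makes the induction go through: differentiating in direction [w] multiplies it by [w],
   and the formula is known on [I] only. *)
suff H (a : R) (g : R^o -> 'rV[R]_e) : (forall t, I t -> g t = a *: f (x + (t : R) *: v)) ->
    Ck_on k I g.
  by apply: (H 1) => t _; rewrite scale1r.
elim: k f cf a g => [|k IH] f cf a g gE /=.
  move=> t It.
  have gnear : \forall s \near (t : R^o), a *: f (x + (s : R) *: v) = g s.
    by near=> s; rewrite gE//; near: s; exact: open_nbhs_nbhs.
  suff h : g s @[s --> (t : R^o)] --> a *: f (x + (t : R) *: v) by rewrite -gE// in h.
  apply: cvg_trans; first exact: near_eq_cvg gnear.
  apply: (@cvgZl_tmp _ _ _ (nbhs (t : R^o)) _ a).
  apply: (@continuous_comp _ _ _ (fun s : R^o => x + (s : R) *: v) f); last exact: cf (IU _ It).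
  apply: (@continuousD _ 'rV[R]_d _ (fun=> x) (fun s : R^o => (s : R) *: v)).
    exact: cst_continuous.
  by apply: (@continuousZr_tmp _ 'rV[R]_d _ (fun s : R^o => s) v); exact: cvg_id.
move: cf => [df cf].
have dg t : I t -> is_derive (t : R^o) (1 : R^o) g (a *: 'D_v f (x + (t : R) *: v)).
  move=> It.
  have h := is_derive_line (ltac:(by apply: diff_derivable; apply: df; exact: IU) :
    derivable f (x + (t : R) *: v) v).
  have h2 : is_derive (t : R^o) (1 : R^o) (a \*: (fun s : R^o => f (x + (s : R) *: v)))
    (a *: 'D_v f (x + (t : R) *: v)) by exact: is_deriveZ.
  apply: (near_eq_is_derive _ h2).
  by near=> s; rewrite gE//; near: s; exact: open_nbhs_nbhs.
split=> [t It|w]; first by apply/derivable1_diffP; case: (dg t It).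
apply: (IH ('D_v f) (cf v) (w * a)) => t It.
have [ex val] := dg t It.
have dgt : differentiable g t by exact/derivable1_diffP.
have {1}-> : w = (w : R) *: (1 : R^o) by rewrite /GRing.scale /= mulr1.
rewrite deriveE//.
have -> : 'd g t ((w : R) *: (1 : R^o)) = w *: 'd g t (1 : R^o) by exact: linearZZ.
have -> : 'd g t (1 : R^o) = a *: 'D_v f (x + (t : R) *: v) by rewrite -val deriveE.
by rewrite scalerA.
Unshelve. all: by end_near. Qed.

End VectorCalculus.

(** * Tangent spaces of submanifolds *)

Section ChartTangentSpace.
Context (R : realType) (d k : nat).
Variables (S U V : set 'rV[R]_d) (phi psi : 'rV[R]_d -> 'rV[R]_d).
Implicit Types (a b p v w y n : 'rV[R]_d).

Lemma sliceP y : slice k y <-> (y <= (pid_mx k : 'M[R]_d))%MS.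
Proof.
split=> [sy|/submxP[D ->] i ki].
  suff -> : y = y *m pid_mx k by exact: submxMl.
  apply/rowP => j; rewrite mxE (bigD1 j)//= mxE eqxx /= big1 ?addr0.
    by have [jk|kj] := ltnP j k; rewrite ?mulr1// mulr0 sy.
  by move=> i ij; rewrite mxE val_eqE (negbTE ij) mulr0.
rewrite mxE big1// => j _; rewrite mxE.
by case: eqP => [->|_]; rewrite ?mulr0//= ltnNge ki mulr0.
Qed.

Hypothesis chart : slice_chart k S U V phi psi.

Let openU : open U. Proof. by case: chart => -[]. Qed.
Let openV : open V. Proof. by case: chart => -[]. Qed.
Let Cphi j : Ck_on j U phi. Proof. by case: chart => _ []. Qed.
Let Cpsi j : Ck_on j V psi. Proof. by case: chart => _ []. Qed.
Let phiP x : U x -> V (phi x) /\ psi (phi x) = x.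
Proof. by case: chart => _ _ + _ _; apply. Qed.
Let psiP y : V y -> U (psi y) /\ phi (psi y) = y.
Proof. by case: chart => _ _ _ + _; apply. Qed.
Let straight x : U x -> S x <-> slice k (phi x).
Proof. by case: chart => _ _ _ _; apply. Qed.

Let dphi x : U x -> differentiable phi x.
Proof. by move=> Ux; have [h _] := Cphi 1; exact: h. Qed.
Let dpsi y : V y -> differentiable psi y.
Proof. by move=> Vy; have [h _] := Cpsi 1; exact: h. Qed.

Lemma diff_psi_phi a v : U a -> 'd psi (phi a) ('d phi a v) = v.
Proof.
move=> Ua; have Vpa : V (phi a) by case: (phiP Ua).
have h : 'D_v (psi \o phi) a = 'D_v id a.
  apply: near_eq_derive; near=> x => /=.
  have Ux : U x by near: x; exact: open_nbhs_nbhs.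
  by case: (phiP Ux).
rewrite derive_id deriveE in h; last first.
  by apply: differentiable_comp; [exact: dphi|exact: dpsi].
by rewrite diff_comp in h; [|exact: dphi|exact: dpsi].
Unshelve. all: by end_near. Qed.

Lemma diff_phi_psi a w : U a -> 'd phi a ('d psi (phi a) w) = w.
Proof.
move=> Ua; have [Vpa pa] := phiP Ua.
have h : 'D_w (phi \o psi) (phi a) = 'D_w id (phi a).
  apply: near_eq_derive; near=> x => /=.
  have Vx : V x by near: x; exact: open_nbhs_nbhs.
  by case: (psiP Vx).
have Upa : differentiable phi (psi (phi a)) by rewrite pa; exact: dphi.
rewrite derive_id deriveE in h; last first.
  by apply: differentiable_comp; [exact: dpsi|].
rewrite diff_comp in h; [|exact: dpsi|by []].
by rewrite /= pa in h.
Unshelve. all: by end_near. Qed.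

Definition chart_tangent a : 'M[R]_d := pid_mx k *m lin1_mx ('d psi (phi a)).

Lemma chart_tangentP a v : U a ->
  (v <= chart_tangent a)%MS <-> exists2 w, slice k w & v = 'D_w psi (phi a).
Proof.
move=> Ua; have [Vpa _] := phiP Ua; split=> [/submxP[D ->]|[w /sliceP wk ->]].
  exists (D *m pid_mx k); first by apply/sliceP; exact: submxMl.
  by rewrite deriveE ?mulmxA ?mul_rV_lin1//; exact: dpsi.
have /submxP[D ->] := wk; rewrite deriveE; last exact: dpsi.
by rewrite -mul_rV_lin1 -mulmxA submxMl.
Qed.

Lemma rank_chart_tangent a : (k <= d)%N -> U a -> \rank (chart_tangent a) = k.
Proof.
move=> kd Ua; rewrite mxrankMfree ?rank_pid_mx//.
apply/row_freeP; exists (lin1_mx ('d phi a)).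
apply/row_matrixP => i.
by rewrite rowE mulmxA !mul_rV_lin1 diff_phi_psi// rowE mulmx1.
Qed.

Lemma slice_add w y : slice k w -> slice k y -> slice k (w + y).
Proof. by move=> sw sy i ki; rewrite mxE sw// sy// addr0. Qed.

Lemma slice_scale (t : R) w : slice k w -> slice k (t *: w).
Proof. by move=> sw i ki; rewrite mxE sw// mulr0. Qed.

(** A slice direction [w] is realised by the curve psi (phi a + t w). Conversely [phi] sends a curve
    in [S] into the slice, where the coordinates from [k] on vanish near 0 and so do their
    derivatives. *)
Lemma tangent_vector_chart a v : U a -> S a ->
  tangent_vector S a v <-> (v <= chart_tangent a)%MS.
Proof.
move=> Ua Sa; have [Vpa pa] := phiP Ua; rewrite chart_tangentP//; split; last first.
  move=> [w sw ->].
  have [r0 r0gt rV] := (nbhs_enormP _ _).1 (open_nbhs_nbhs (conj openV Vpa)).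
  pose e := r0 / (enorm w + 1).
  have w1 : 0 < enorm w + 1 by rewrite ltr_wpDl ?enorm_ge0.
  have inV (t : R) : - e < t < e -> V (phi a + t *: w).
    move=> te; apply: rV; rewrite addrAC subrr add0r enormZ.
    have : `|t| < e by rewrite ltr_norml.
    rewrite /e ltr_pdivlMr// => h; apply: le_lt_trans h.
    by rewrite ler_wpM2l// lerDl.
  exists e, (fun t : R^o => psi (phi a + (t : R) *: w)); split.
  - by rewrite divr_gt0.
  - move=> j; apply: (Ck_on_line (U := V)) => //.
    rewrite (_ : [set _ | _] = `](- e : R), e[%classic); last first.
      by apply/seteqP; split=> t /=; rewrite in_itv.
    exact: interval_open.
  - move=> t te; have [Ux px] := psiP (inV t te).
    apply/straight => //; rewrite px.
    by apply: slice_add; [exact/straight|exact: slice_scale].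
  - by rewrite scale0r addr0.
  have dl : derivable psi (phi a + (0 : R) *: w) w.
    by apply: diff_derivable; apply: dpsi; rewrite scale0r addr0.
  by have [_ ->] := is_derive_line dl; rewrite scale0r addr0.
move=> [e [c [e0 smc Sc c0 Dc]]].
have I0 : - e < 0 < e by rewrite oppr_lt0 e0.
have dc : differentiable c (0 : R^o) by case: (smc 1) => + _; apply.
exists ('d phi a v); last by rewrite deriveE ?diff_psi_phi//; exact: dpsi.
have dpc : differentiable phi (c 0) by rewrite c0; exact: dphi.
have Dpc : 'D_(1 : R^o) (phi \o c) 0 = 'd phi a v.
  rewrite deriveE; last exact: differentiable_comp.
  have dcv : ('d c (0 : R^o)) (1 : R^o) = v by rewrite -Dc deriveE.
  rewrite diff_comp//; transitivity ('d phi (c 0) ('d c (0 : R^o) (1 : R^o))); first by [].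
  by rewrite dcv c0.
have near0 : \forall t \near (0 : R^o), slice k (phi (c t)).
  have cU : \forall t \near (0 : R^o), U (c t).
    apply: (differentiable_continuous dc); rewrite c0.
    exact: open_nbhs_nbhs.
  have ce : \forall t \near (0 : R^o), - e < (t : R) < e.
    have : nbhs (0 : R) (`](- e : R), e[%classic : set R).
      by apply: open_nbhs_nbhs; split; [exact: interval_open|rewrite /= in_itv].
    by apply: filterS => t /=; rewrite in_itv.
  by near=> t; apply/straight; [|apply: Sc]; near: t.
move=> i ki; rewrite -Dpc.
have der : derivable (phi \o c) (0 : R^o) (1 : R^o).
  by apply: diff_derivable; exact: differentiable_comp.
have dotd u : dot u 'e_i = u 0 i :> R.
  rewrite /dot (bigD1 i)//= mxE !eqxx mulr1 big1 ?addr0// => j ji.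
  by rewrite mxE (negbTE ji) andbF mulr0.
rewrite -dotd; have [_ <-] := is_derive_dot 'e_i der.
have -> : 'D_(1 : R^o) (fun s : R^o => dot ((phi \o c) s) 'e_i : R^o) 0 =
    'D_(1 : R^o) (fun=> 0 : R^o) (0 : R^o).
  apply: near_eq_derive; near=> t; rewrite dotd.
  have : slice k (phi (c t)) by near: t.
  by move=> /(_ i ki).
exact: derive_cst.
Unshelve. all: by end_near. Qed.

(** phi b - phi a is a slice vector, so [psi] maps it to first order to a tangent vector at [a],
    orthogonal to [n]. The remainder is quadratic by [C2_taylor], and [phi] is Lipschitz. *)
Lemma chart_quadratic p : U p -> S p ->
  exists r C, [/\ 0 < r, 0 <= C & forall a b n, S a -> S b ->
    enorm (a - p) < r -> enorm (b - p) < r ->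
    (forall v, tangent_vector S a v -> dot v n = 0) ->
    dot (b - a) n <= C * enorm n * enorm (b - a) ^+ 2].
Proof.
move=> Up Sp; have [Vpp _] := phiP Up.
have [r1 [C1 [r1gt C1ge rU lip]]] := C1_lipschitz openU Up (Cphi 1).
have [r2 [C2 [r2gt C2ge rV tay]]] := C2_taylor openV Vpp (Cpsi 2).
pose r := Num.min r1 (r2 / (C1 + 1)).
have C11 : 0 < C1 + 1 by rewrite ltr_wpDl.
exists r, (C2 * C1 ^+ 2); split; first by rewrite lt_min r1gt divr_gt0.
  by rewrite mulr_ge0 ?sqr_ge0.
move=> a b n Sa Sb; rewrite !lt_min => /andP[ar1 ar2] /andP[br1 br2] an.
have pp1 : enorm (p - p) < r1 by rewrite subrr enorm0.
have close x : enorm (x - p) < r1 -> enorm (x - p) < r2 / (C1 + 1) ->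
    enorm (phi x - phi p) < r2.
  move=> x1 x2; apply: le_lt_trans (lip _ _ x1 pp1) _.
  move: x2; rewrite ltr_pdivlMr// mulrC; apply: le_lt_trans.
  by rewrite ler_wpM2r ?enorm_ge0// lerDl.
have Ua := rU _ ar1; have Ub := rU _ br1.
have [Va pa] := phiP Ua; have [Vb pb] := phiP Ub.
have := tay (phi a) (phi b) n (close _ ar1 ar2) (close _ br1 br2).
rewrite pa pb => h; apply: (le_trans (h _)).
  apply: an; apply/tangent_vector_chart => //; apply/chart_tangentP => //.
  exists (phi b - phi a) => //; rewrite -scaleN1r.
  by apply: slice_add; [exact/straight|apply: slice_scale; exact/straight].
rewrite [leRHS](_ : _ = C2 * enorm n * (C1 * enorm (b - a)) ^+ 2); last by ring.
apply: ler_wpM2l; first by rewrite mulr_ge0 ?enorm_ge0.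
rewrite ler_sqr ?nnegrE ?mulr_ge0 ?enorm_ge0//; exact: lip.
Qed.

End ChartTangentSpace.

(** * The medial axis *)

Section Submanifold.
Context (R : realType) (d k : nat) (S : set 'rV[R]_d).
Implicit Types (a b m n p q v w x : 'rV[R]_d) (r s t : R).

Hypothesis kd : (k < d)%N.
Hypothesis cS : compact S.
Hypothesis mS : smooth_submanifold k S.

Lemma tangent_space_exists : exists T : 'rV[R]_d -> 'M[R]_d, forall p, S p ->
  \rank (T p) = k /\ forall v, tangent_vector S p v <-> (v <= T p)%MS.
Proof.
have /choice[T hT] : forall p, exists A : 'M[R]_d, S p ->
    \rank A = k /\ forall v, tangent_vector S p v <-> (v <= A)%MS.
  move=> p; have [Sp|nSp] := pselect (S p); last by exists 0.
  have [U [V [phi [psi [Up ch]]]]] := mS Sp.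
  exists (chart_tangent k phi psi p) => _; split.
    by apply: (rank_chart_tangent ch) => //; exact: ltnW.
  by move=> v; exact: (tangent_vector_chart ch).
by exists T.
Qed.

Variable T : 'rV[R]_d -> 'M[R]_d.
Hypothesis rT : forall p, S p -> \rank (T p) = k.
Hypothesis TP : forall p v, S p -> tangent_vector S p v <-> (v <= T p)%MS.

Lemma tangent_approx b v e : S b -> (v <= T b)%MS -> 0 < e ->
  exists2 s0 : R, 0 < s0 & forall s, 0 < s < s0 ->
    exists2 b', S b' & enorm (b' - b - s *: v) <= e * s.
Proof.
move=> Sb /(TP _ Sb)[e1 [c [e10 smc Sc c0 Dc]]] e0.
have dc : derivable c (0 : R^o) (1 : R^o).
  apply: diff_derivable; case: (smc 1) => + _; apply.
  by rewrite /= oppr_lt0 e10.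
have : \forall h \near (0 : R)^',
    enorm (h^-1 *: ((c \o shift 0) (h *: (1 : R^o)) - c 0) - v) < e.
  have cv : (h^-1 *: ((c \o shift 0) (h *: (1 : R^o)) - c 0)) @[h --> (0 : R)^'] --> v.
    by rewrite -Dc.
  have := cv [set y : 'rV[R]_d | enorm (y - v) < e]; apply.
  by apply/nbhs_enormP; exists e.
move=> /nbhs_ballP[r /= r0 hr].
exists (Num.min r e1); first by rewrite lt_min r0.
move=> s /andP[s0]; rewrite lt_min => /andP[sr se].
exists (c s); first by apply: Sc; rewrite se andbT (lt_trans _ s0)// oppr_lt0.
have := hr s; rewrite -ball_normE /= sub0r normrN gtr0_norm// => /(_ sr).
rewrite gt_eqF// => /(_ isT); rewrite /shift /= addr0 c0.
have -> : s *: (1 : R^o) = s by rewrite /GRing.scale /= mulr1.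
move=> h.
have -> : c s - b - s *: v = s *: (s^-1 *: (c s - b) - v).
  by rewrite scalerBr scalerA divff ?scale1r// gt_eqF.
by rewrite enormZ gtr0_norm// mulrC ler_pM2r// ltW.
Qed.

Lemma local_quadratic p : S p ->
  exists r C, [/\ 0 < r, 0 <= C & forall a b n, S a -> S b ->
    enorm (a - p) < r -> enorm (b - p) < r -> (n <= orth (T a))%MS ->
    dot (b - a) n <= C * enorm n * enorm (b - a) ^+ 2].
Proof.
move=> Sp; have [U [V [phi [psi [Up ch]]]]] := mS Sp.
have [r [C [r0 C0 h]]] := chart_quadratic ch Up Sp.
exists r, C; split=> // a b n Sa Sb ar br nN; apply: h => // v /(TP _ Sa) vT.
by rewrite dotC (dot_orth nN vT).
Qed.

Lemma nearest_point_normal x a : nearest_point S x a -> (x - a <= orth (T a))%MS.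
Proof.
move=> [Sa h]; apply: (normal_of_ball tangent_approx Sa (ltr0Sn R 1)) => b Sb.
have := h _ Sb; rewrite /dist enorm_le ?enorm_ge0// sqr_enorm.
rewrite (_ : x - b = (x - a) - (b - a)); last first.
  by apply/rowP => i; rewrite !mxE; ring.
by move: (x - a) (b - a) => u w; rewrite !dotE (dotC w u); lra.
Qed.

(** Nearby points avoid the ball by the quadratic bound, since 2 t C <= 1; points at distance at
    least [r] are no closer to [b] than its diameter 2 t. *)
Lemma small_normal_ball b m : S b -> (m <= orth (T b))%MS -> enorm m = 1 ->
  exists2 t, 0 < t & nearest_point S (b + t *: m) b.
Proof.
move=> Sb mN m1; have [r [C [r0 C0 h]]] := local_quadratic Sb.
pose t := Num.min (r / 2) (1 / (2 * (C + 1))).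
have C1 : 0 < C + 1 by rewrite ltr_wpDl.
have t0 : 0 < t by rewrite lt_min !divr_gt0// mulr_gt0.
have tr : t <= r / 2 by rewrite ge_min lexx.
have tC : t <= 1 / (2 * (C + 1)) by rewrite ge_min lexx orbT.
exists t => //; apply/nearest_pointP => //; first exact: ltW.
move=> b' Sb'; rewrite -sqr_enorm; have nb := enorm_ge0 (b' - b).
have [br|br] := ltP (enorm (b' - b)) r.
  have := h b b' m Sb Sb' _ br mN; rewrite subrr enorm0 m1 mulr1 dotC => /(_ r0) hq.
  have : 2 * t * C <= 1.
    move: tC; rewrite ler_pdivlMr ?mulr_gt0//; nra.
  have := sqr_ge0 (enorm (b' - b)) => sq0.
  have : 2 * t * dot m (b' - b) <= 2 * t * (C * enorm (b' - b) ^+ 2).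
    by rewrite ler_pM2l// mulr_gt0.
  by move=> h1 h2; apply: (le_trans h1); nra.
have := dot_le m (b' - b); rewrite m1 mul1r => hm.
apply: (@le_trans _ _ (2 * t * enorm (b' - b))); first by rewrite ler_pM2l// mulr_gt0.
by rewrite expr2 ler_wpM2r//; lra.
Qed.

(** For two nearest points, |b - a|^2 = 2 dot (b - a) (x - a) <= 2 C |x - p| |b - a|^2, where 2 C |x
    - p| < 1. *)
Lemma unique_nearest_near p : S p ->
  exists2 r, 0 < r & forall x, enorm (x - p) < r -> unique_nearest S x.
Proof.
move=> Sp; have [r [C [r0 C0 h]]] := local_quadratic Sp.
pose t := Num.min (r / 2) (1 / (2 * (C + 1))).
have C1 : 0 < C + 1 by rewrite ltr_wpDl.
exists t; first by rewrite lt_min !divr_gt0// mulr_gt0.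
move=> x; rewrite lt_min => /andP[xr xC] a b na nb.
have close c : nearest_point S x c -> enorm (c - p) < r.
  move=> [Sc hc]; have := hc _ Sp; rewrite /dist => h1.
  have := enormD_triangle x c p; rewrite (enormB c x); lra.
have ba : dist x a = dist x b.
  by apply/eqP; rewrite eq_le (na.2 _ nb.1) (nb.2 _ na.1).
have := h a b (x - a) na.1 nb.1 (close _ na) (close _ nb) (nearest_point_normal na).
have xa : enorm (x - a) <= enorm (x - p) by exact: na.2.
have E : 2 * dot (b - a) (x - a) = enorm (b - a) ^+ 2.
  have : dot (x - b) (x - b) = dot (x - a) (x - a) by rewrite -!sqr_enorm -/(dist x b) -ba.
  rewrite (_ : x - b = (x - a) - (b - a)); last first.
    by apply/rowP => i; rewrite !mxE; ring.
  rewrite sqr_enorm; move: (x - a) (b - a) => u w.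
  by rewrite !dotE (dotC w u); lra.
move=> hq; apply/eqP; rewrite eq_sym -subr_eq0 -enorm_eq0 -sqrf_eq0; apply/eqP.
apply/eqP; rewrite eq_le sqr_ge0 andbT leNgt; apply/negP => pos.
have : enorm (b - a) ^+ 2 <= 2 * C * enorm (x - p) * enorm (b - a) ^+ 2.
  rewrite -{1}E -!mulrA ler_pM2l// (le_trans hq)// -mulrA ler_wpM2l//.
  by rewrite ler_wpM2r// ltW.
rewrite leNgt gtr_pMl// => /negP; apply.
move: xC; rewrite ltr_pdivlMr ?mulr_gt0// => xC.
by have := enorm_ge0 (x - p); nra.
Qed.

(** The infimum of the empty set is 0 by convention, so positivity presupposes a nonempty medial
    axis. *)
Lemma lfs_gt0 p : S p -> medial_axis S !=set0 -> 0 < lfs S p.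
Proof.
move=> Sp [m0 Mm0]; have [r r0 hr] := unique_nearest_near Sp.
apply: (lt_le_trans r0); apply: lb_le_inf; first by exists (dist p m0), m0.
move=> _ [m Mm <-]; rewrite leNgt; apply/negP => mr.
have [] := Mm [set y | enorm (y - p) < r].
  apply/nbhs_enormP; exists (r - enorm (m - p)).
    by rewrite subr_gt0 enormB.
  by move=> y; rewrite ltrBrDr /=; apply: le_lt_trans; exact: enormD_triangle.
by move=> y [[a [b [na nb]]]] ab yr; apply: ab; exact: hr yr _ _ na nb.
Qed.

Lemma unique_nearest_lfs p x : enorm (x - p) < lfs S p -> unique_nearest S x.
Proof.
move=> xr a b na nb; apply: contrapT => ab.
have Mx : medial_axis S x by apply: subset_closure; exists a, b.
move: xr; rewrite ltNge => /negP; apply; rewrite enormB.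
apply: ge_inf; last by exists x.
by exists 0 => _ [m _ <-]; exact: enorm_ge0.
Qed.

Lemma nearest_point_lfs p b m t : S b -> (m <= orth (T b))%MS -> enorm m = 1 ->
    0 <= t -> enorm (b - p) < lfs S p -> enorm (b + t *: m - p) <= lfs S p ->
  nearest_point S (b + t *: m) b.
Proof.
move=> Sb mN m1 t0 bL tL; have [s0 s0gt ns0] := small_normal_ball Sb mN m1.
apply: (nearest_point_ray cS Sb m1 s0gt t0 ns0) => s /andP[sgt st].
have sL : enorm (b + s *: m - p) < lfs S p.
  have tgt : 0 < t by exact: lt_trans st.
  (* By convexity the intermediate centres are strictly within [lfs S p] of [p], even if the last
     one is on the boundary. *)
  have -> : b + s *: m - p = (1 - s / t) *: (b - p) + (s / t) *: (b + t *: m - p).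
    apply/rowP => i; rewrite !mxE; field; exact: lt0r_neq0.
  have u0 : 0 <= 1 - s / t by rewrite subr_ge0 ler_pdivrMr// mul1r ltW.
  have u1 : 0 < 1 - s / t by rewrite subr_gt0 ltr_pdivrMr// mul1r.
  have u2 : 0 < s / t by rewrite divr_gt0.
  apply: (le_lt_trans (enormD _ _)); rewrite !enormZ !gtr0_norm//.
  have h1 : (1 - s / t) * enorm (b - p) < (1 - s / t) * lfs S p by rewrite ltr_pM2l.
  have h2 : s / t * enorm (b + t *: m - p) <= s / t * lfs S p by rewrite ler_pM2l.
  lra.
exists (lfs S p - enorm (b + s *: m - p)); first by rewrite subr_gt0.
move=> y; rewrite ltrBrDr => yr; apply: unique_nearest_lfs.
by apply: le_lt_trans yr; exact: enormD_triangle.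
Qed.

Hypothesis k1 : (1 <= k)%N.

(* If the medial axis were empty, all normal balls would be empty and S would
   lie in each of its tangent flats; at a point farthest from the origin this
   leaves a single point. *)
Lemma medial_axis_nonempty : S !=set0 -> medial_axis S !=set0.
Proof.
move=> S0; apply: contrapT => M0.
have uniq x : unique_nearest S x.
  move=> a b na nb; apply: contrapT => ab; apply: M0; exists x.
  by apply: subset_closure; exists a, b.
have all_balls b m t : S b -> (m <= orth (T b))%MS -> enorm m = 1 -> 0 <= t ->
    nearest_point S (b + t *: m) b.
  move=> Sb mN m1 t0; have [s0 s0gt ns0] := small_normal_ball Sb mN m1.
  by apply: (nearest_point_ray cS Sb m1 s0gt t0 ns0) => s _; exists 1.
have le0 b m b' : S b -> (m <= orth (T b))%MS -> enorm m = 1 -> S b' ->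
    dot m (b' - b) <= 0.
  move=> Sb mN m1 Sb'; rewrite leNgt; apply/negP => pos.
  (* A radius so large that the ball would contain [b']. *)
  pose t := (dot (b' - b) (b' - b) + 1) / dot m (b' - b).
  have t0 : 0 <= t by rewrite divr_ge0 ?addr_ge0 ?dot_ge0// ltW.
  have := (nearest_pointP Sb m1 t0).1 (all_balls _ _ _ Sb mN m1 t0) _ Sb'.
  rewrite -mulrA divfK ?gt_eqF//.
  by have := dot_ge0 (b' - b); lra.
have flat b b' : S b -> S b' -> (b' - b <= T b)%MS.
  move=> Sb Sb'; rewrite -(orthK (T b)); apply/orthP => m mN.
  have [->|m0] := eqVneq m 0; first exact: dot0r.
  have [u u1 mE] := unit_vector m0.
  have uN : (u <= orth (T b))%MS.
    have <- : (enorm m)^-1 *: m = u.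
      by rewrite {2}mE scalerA mulVf ?scale1r// gt_eqF// enorm_gt0.
    exact: scalemx_sub.
  suff h : dot u (b' - b) = 0 by rewrite mE dotZr dotC h mulr0.
  apply/eqP; rewrite eq_le le0//= -oppr_le0 -dotNl.
  by apply: (@le0 b); rewrite ?eqmx_opp// enormN.
have [a Sa ha] := compact_EVT_max S0 cS
  (continuous_subspaceT (A := S) (@continuous_enorm R d)).
rewrite inE in Sa.
have far b : S b -> 2 * dot a (b - a) <= - dot (b - a) (b - a).
  move=> Sb; have := ha b; rewrite inE => /(_ Sb).
  rewrite enorm_le ?enorm_ge0// sqr_enorm -{1 2}(subrK a b).
  by move: (b - a) => w; rewrite !dotE (dotC w a); lra.
have aN : (a <= orth (T a))%MS.
  apply: (normal_of_ball tangent_approx Sa (ltr0Sn R 1)) => b Sb.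
  by have := far _ Sb; have := dot_ge0 (b - a); lra.
have single b : S b -> b = a.
  move=> Sb; have := far _ Sb; rewrite (dot_orth aN (flat _ _ Sa Sb)) mulr0.
  rewrite oppr_ge0 => h; apply/eqP; rewrite -subr_eq0 -dot_eq0.
  by rewrite eq_le h dot_ge0.
have Tk : \rank (T a) != 0%N by rewrite (rT Sa) -lt0n.
have [v v0 vT] := exists_nonzero_submx Tk.
have nv : 0 < enorm v by rewrite enorm_gt0.
have [s0 s0gt hs] := tangent_approx Sa vT (ltac:(by rewrite divr_gt0) : 0 < enorm v / 2).
have [|b Sb] := hs (s0 / 2); first by rewrite divr_gt0//=; lra.
rewrite (single _ Sb) subrr sub0r enormN enormZ gtr0_norm ?divr_gt0//.
have := mulr_gt0 s0gt nv; lra.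
Qed.

End Submanifold.

(** * Bounds on the angles *)

Section TangentAngles.
Context (R : realType) (d k : nat) (S : set 'rV[R]_d).
Implicit Types (a b m n p q v w x : 'rV[R]_d) (r s t : R).

Lemma dist_set_aflat q p (W : 'M[R]_d) :
  dist_set q (aflat p W) = enorm (proj (orth W) (q - p)).
Proof.
apply: inf_minimum.
  exists (p + proj W (q - p)); first by exists (proj W (q - p)); rewrite //= proj_sub.
  by rewrite /dist projC opprD addrA.
move=> _ [_ [v /= vW <-] <-]; rewrite /dist opprD addrA.
apply: le_trans (enorm_proj (orth W) _).
by rewrite [proj _ (_ - v)]projB [proj _ v]projC (proj_id vW) subrr subr0.
Qed.

Variable T : 'rV[R]_d -> 'M[R]_d.
Hypothesis TP : forall p v, S p -> tangent_vector S p v <-> (v <= T p)%MS.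

Lemma tangent_flatE p : S p -> tangent_flat S p = aflat p (T p).
Proof.
move=> Sp; apply/seteqP; split=> _ [v /= vT <-]; exists v => //=.
  exact/TP.
exact/(TP _ Sp).
Qed.

Lemma normal_flatE p : S p -> normal_flat S p = aflat p (orth (T p)).
Proof.
move=> Sp; rewrite /normal_flat tangent_flatE//.
have pv v : p + v - p = v by rewrite addrAC subrr add0r.
apply/seteqP; split=> x /=.
  move=> h; apply/aflatE/orthP => v vT.
  have := h (p + v); rewrite pv dotC; apply.
  by exists v.
by move=> /aflatE h _ [v /= vT <-]; rewrite pv dotC (dot_orth h).
Qed.

Hypothesis rT : forall p, S p -> \rank (T p) = k.
Hypothesis k1 : (1 <= k)%N.
Hypothesis kd : (k < d)%N.

Let rT0 p : S p -> \rank (T p) != 0%N.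
Proof. by move=> Sp; rewrite rT// -lt0n. Qed.

Let rN0 p : S p -> \rank (orth (T p)) != 0%N.
Proof. by move=> Sp; rewrite mxrank_orth rT// subn_eq0 -ltnNge. Qed.

(** Passing to orthogonal complements swaps the two spaces; equality of ranks swaps them back. *)
Lemma normal_angle_tangent_angle p q : S p -> S q ->
  flat_angle (normal_flat S p) (normal_flat S q) =
  flat_angle (tangent_flat S p) (tangent_flat S q).
Proof.
move=> Sp Sq; rewrite !normal_flatE// !tangent_flatE//.
apply: flat_angle_eq; rewrite ?rT0 ?rN0// => c c1.
have [c0 _] := andP c1.
have rN : \rank (orth (T p)) = \rank (orth (T q)) by rewrite !mxrank_orth !rT.
split=> h.
  move=> u uT; rewrite -(proj_eqmx _ (orthK (T q))).
  apply: (proj_ge_orth c1 (V := orth (T q)) (W := orth (T p))); last by rewrite orthK.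
  by apply: proj_ge_sym h.
by apply: proj_ge_sym => //; exact: proj_ge_orth h.
Qed.

Hypothesis cS : compact S.
Hypothesis mS : smooth_submanifold k S.

(** Transport along the similarity x -> p + lfs x, which leaves tangent directions unchanged. The
    conclusion 2 rN <= r^2 serves to compare [eta_normal] with [eta2]. *)
Lemma manifold_normal_bound p q m : S p -> S q -> 0 < lfs S p ->
    let r := dist p q / lfs S p in
    let rN := dist_set q (tangent_flat S p) / lfs S p in
    r ^+ 4 + r ^+ 2 < 1 -> (m <= orth (T q))%MS -> enorm m = 1 ->
  2 * rN <= r ^+ 2 /\
  (1 - r ^+ 2 / (2 * Num.sqrt (1 - r ^+ 2))) ^+ 2 - rN ^+ 2 / (1 - r ^+ 2)
    <= enorm (proj (orth (T p)) m) ^+ 2.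
Proof.
move=> Sp Sq L0 r rN hr mN m1; set L := lfs S p in L0 r rN hr *.
pose f x := p + L *: x; pose g x := L^-1 *: (x - p).
have Ln0 : L != 0 by rewrite gt_eqF.
have gK x : f (g x) = x by rewrite /f /g scalerA divff// scale1r addrC subrK.
have fK x : g (f x) = x.
  by rewrite /f /g addrAC subrr add0r scalerA mulVf// scale1r.
pose S' := [set x | S (f x)]; pose T' x := T (f x).
have fB x y : f x - f y = L *: (x - y).
  by rewrite /f scalerBr; apply/rowP => i; rewrite !mxE; ring.
have cS' : compact S'.
  have -> : S' = g @` S.
    apply/seteqP; split=> [x Sx|_ [x Sx <-]]; first by exists (f x).
    by rewrite /S' /= gK.
  apply: continuous_compact cS; apply: continuous_subspaceT.
  apply: (@enorm_lipschitz_map _ _ _ _ L^-1) => x y.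
  rewrite /g -scalerBr enormZ gtr0_norm ?invr_gt0//.
  by rewrite opprB addrA subrK.
have f0 : f 0 = p by rewrite /f scaler0 addr0.
have S'0 : S' 0 by rewrite /S' /= f0.
have approx b v e : S' b -> (v <= T' b)%MS -> 0 < e ->
    exists2 s0 : R, 0 < s0 & forall s, 0 < s < s0 ->
    exists2 b', S' b' & enorm (b' - b - s *: v) <= e * s.
  move=> Sb vT e0; have [s0 s0gt hs] := tangent_approx TP Sb vT e0.
  exists (s0 / L); first by rewrite divr_gt0.
  move=> s /andP[sgt]; rewrite ltr_pdivlMr// => sL.
  have [|b' Sb' hb'] := hs (s * L); first by rewrite mulr_gt0.
  exists (g b'); first by rewrite /S' /= gK.
  rewrite -(ler_pM2l L0) -{1}(gtr0_norm L0) -enormZ !scalerBr -scalerBr -fB gK.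
  by rewrite scalerA mulrC (le_trans hb')// mulrA mulrC.
have fp x : enorm (f x - p) = L * enorm x.
  by rewrite /f addrAC subrr add0r enormZ gtr0_norm.
have balls b n t : S' b -> (n <= orth (T' b))%MS -> enorm n = 1 -> 0 <= t ->
    enorm b < 1 -> enorm (b + t *: n) <= 1 ->
    forall b', S' b' -> 2 * t * dot n (b' - b) <= dot (b' - b) (b' - b).
  move=> Sb nN n1 t0 b1 bt b' Sb'.
  have Lt0 : 0 <= L * t by rewrite mulr_ge0// ltW.
  have fbt : f b + (L * t) *: n = f (b + t *: n).
    by rewrite /f scalerDr scalerA addrA.
  have h : nearest_point S (f b + (L * t) *: n) (f b).
    apply: (nearest_point_lfs (p := p) cS mS TP) => //.
    - by rewrite fp -/L gtr_pMr.
    - by rewrite fbt fp -/L ger_pMr.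
  have := (nearest_pointP (S := S) (b := f b) Sb n1 Lt0).1 h (f b') Sb'.
  rewrite fB !dotZr dotZl => h2.
  rewrite -(ler_pM2l (exprn_gt0 2 L0)); lra.
have fg : f (g q) = q by exact: gK.
have Sgq : S' (g q) by rewrite /S' /= gK.
have rE : enorm (g q) = r.
  by rewrite /g enormZ gtr0_norm ?invr_gt0// mulrC -enormB.
have NE : enorm (proj (orth (T' 0)) (g q)) = rN.
  rewrite /rN tangent_flatE// dist_set_aflat /T' f0 /g projZ enormZ.
  by rewrite gtr0_norm ?invr_gt0// mulrC.
have gN : (m <= orth (T' (g q)))%MS by rewrite /T' gK.
split.
  by have := normal_part_le S'0 balls Sgq; rewrite NE rE.
have := normal_angle_bound cS' S'0 approx balls Sgq _ gN m1.
by rewrite NE rE /T' f0; apply.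
Qed.

End TangentAngles.

(** * The golden-ratio threshold and comparison of the angle functions *)

Section AngleFunctions.
Context (R : realType).
Implicit Types r rN : R.

Lemma radius_bound r : 0 <= r -> r < Num.sqrt ((Num.sqrt 5 - 1) / 2) ->
  r ^+ 4 + r ^+ 2 < 1.
Proof.
move=> r0; have s5 : Num.sqrt (5 : R) ^+ 2 = 5 by rewrite sqr_sqrtr.
have s50 : 0 <= Num.sqrt (5 : R) by exact: sqrtr_ge0.
set g := _ / 2; have g0 : 0 <= g by rewrite /g divr_ge0//; nra.
rewrite -ltr_sqr ?nnegrE ?sqrtr_ge0// sqr_sqrtr// => rg.
have gg : g ^+ 2 + g = 1 by rewrite /g; nra.
rewrite (_ : r ^+ 4 = (r ^+ 2) ^+ 2) -?exprM//.
by have := sqr_ge0 r; nra.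
Qed.

(** With u = r^2 / s the radicand is 1 - u + u^2 / 4 - (rN / s)^2. The hypothesis on [r] says u < 1,
    and 2 rN <= r^2 says (rN / s)^2 <= u^2 / 4. *)
Lemma eta_normal_radicand r rN : 0 <= r -> r ^+ 4 + r ^+ 2 < 1 ->
    0 <= rN -> 2 * rN <= r ^+ 2 ->
  let s := Num.sqrt (1 - r ^+ 2) in
  [/\ 0 <= 1 - r ^+ 2 / s,
    1 - r ^+ 2 / s <= (1 - r ^+ 2 / (2 * s)) ^+ 2 - rN ^+ 2 / (1 - r ^+ 2),
    (1 - r ^+ 2 / (2 * s)) ^+ 2 - rN ^+ 2 / (1 - r ^+ 2) <= 1 &
    0 <= 1 - r ^+ 2 / (2 * s)].
Proof.
move=> r0 hr rN0 hN s.
have r4 : r ^+ 4 = (r ^+ 2) ^+ 2 by rewrite -exprM.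
have r2 : 0 <= r ^+ 2 by exact: sqr_ge0.
have pos : 0 < 1 - r ^+ 2 by rewrite r4 in hr; have := sqr_ge0 (r ^+ 2); lra.
have s2 : s ^+ 2 = 1 - r ^+ 2 by rewrite sqr_sqrtr// ltW.
have s0 : 0 < s by rewrite sqrtr_gt0.
have rs : r ^+ 2 < s.
  by rewrite -ltr_sqr ?nnegrE ?(ltW s0)// s2 -r4; lra.
have u1 : r ^+ 2 / s < 1 by rewrite ltr_pdivrMr// mul1r.
have u0 : 0 <= r ^+ 2 / s by rewrite divr_ge0// ltW.
have hE : r ^+ 2 / (2 * s) = r ^+ 2 / s / 2 by rewrite invfM mulrA mulrAC.
rewrite hE -s2; split; try lra.
  have : rN ^+ 2 / s ^+ 2 <= (r ^+ 2 / s / 2) ^+ 2.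
    rewrite -expr_div_n ler_sqr ?nnegrE; last 2 first.
    - by rewrite divr_ge0// ltW.
    - by rewrite divr_ge0.
    by rewrite mulrAC ler_pM2r ?invr_gt0//; lra.
  nra.
have : 0 <= rN ^+ 2 / s ^+ 2 by rewrite divr_ge0 ?sqr_ge0.
nra.
Qed.

Lemma eta_normal_le_eta2 r rN : 0 <= r -> r ^+ 4 + r ^+ 2 < 1 ->
  0 <= rN -> 2 * rN <= r ^+ 2 -> eta_normal r rN <= eta2 r.
Proof.
move=> r0 hr rN0 hN; have [e0 e1 e2 _] := eta_normal_radicand r0 hr rN0 hN.
have sq1 (x : R) : 0 <= x -> x <= 1 -> -1 <= Num.sqrt x <= 1.
  move=> x0 x1; rewrite (le_trans _ (sqrtr_ge0 x)) ?lerN10//=.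
  by rewrite -[leRHS]sqrtr1 ler_wsqrtr.
rewrite /eta_normal /eta2 ler_acos ?ler_wsqrtr// sq1//.
- exact: le_trans e1.
- exact: le_trans e2.
Qed.

Lemma eta_normal0 r : 0 <= r -> r ^+ 4 + r ^+ 2 < 1 -> eta_normal r 0 = eta1 r.
Proof.
move=> r0 hr; have [|_ _ _ z0] := @eta_normal_radicand r 0 r0 hr (lexx _).
  by rewrite mulr0 sqr_ge0.
by rewrite /eta_normal expr0n mul0r subr0 sqrtr_sqr ger0_norm.
Qed.

End AngleFunctions.

Lemma lemma6_bounds (R : realType) (d k : nat) (S : set 'rV[R]_d) (p q : 'rV[R]_d) :
  (1 <= k)%N -> (k < d)%N -> compact S -> smooth_submanifold k S -> S p -> S q ->
  let delta := dist p q / lfs S p in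
  let deltaN := dist_set q (tangent_flat S p) / lfs S p in
  let angleN := flat_angle (normal_flat S p) (normal_flat S q) in
  let angleT := flat_angle (tangent_flat S p) (tangent_flat S q) in
  delta < Num.sqrt ((Num.sqrt 5 - 1) / 2) ->
  [/\ angleN = angleT,
      angleT <= eta2 delta,
      angleN <= eta_normal delta deltaN,
      eta_normal delta deltaN <= eta2 delta &
      (tangent_flat S p q <-> deltaN = 0) /\
      (tangent_flat S p q -> eta_normal delta deltaN = eta1 delta)].
Proof.
move=> k1 kd cS mS Sp Sq r rN angleN angleT hr.
have [T hT] := tangent_space_exists kd mS.
have rT x : S x -> \rank (T x) = k by move=> /hT[].
have TP x v : S x -> tangent_vector S x v <-> (v <= T x)%MS by move=> /hT[].
have M0 : medial_axis S !=set0.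
  by apply: (medial_axis_nonempty cS mS rT TP k1); exists p.
have L0 : 0 < lfs S p by exact: (lfs_gt0 mS TP).
have r0 : 0 <= r by rewrite divr_ge0 ?enorm_ge0// ltW.
have r41 := radius_bound r0 hr.
have tE x : S x -> tangent_flat S x = aflat x (T x) by exact: tangent_flatE.
have nE x : S x -> normal_flat S x = aflat x (orth (T x)) by exact: normal_flatE.
have rN0 : 0 <= rN by rewrite /rN tE// dist_set_aflat divr_ge0 ?enorm_ge0// ltW.
have rkN x : S x -> \rank (orth (T x)) != 0%N.
  by move=> Sx; rewrite mxrank_orth rT// subn_eq0 -ltnNge.
have NT : angleN = angleT by exact: (normal_angle_tangent_angle TP rT k1 kd).
have bound m : (m <= orth (T q))%MS -> enorm m = 1 -> _ :=
  manifold_normal_bound TP cS mS Sp Sq L0 r41.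
have [v0 v0n v0N] := exists_nonzero_submx (rkN _ Sq).
have unitN v : v != 0 -> (v <= orth (T q))%MS ->
    exists2 m, (m <= orth (T q))%MS & enorm m = 1 /\ v = enorm v *: m.
  move=> vn vN; have [m m1 mE] := unit_vector vn; exists m => //.
  have <- : (enorm v)^-1 *: v = m.
    by rewrite {2}mE scalerA mulVf ?scale1r// gt_eqF// enorm_gt0.
  exact: scalemx_sub.
have hN : 2 * rN <= r ^+ 2.
  by have [m mN [m1 _]] := unitN _ v0n v0N; have [] := bound m mN m1.
have [e0 e1 e2 z0] := eta_normal_radicand r0 r41 rN0 hN.
have le_eta : angleN <= eta_normal r rN.
  (* The available bound projects normals at [q] to the normal space at [p], so the angle is first
     reversed. *)
  have -> : angleN = flat_angle (aflat q (orth (T q))) (aflat p (orth (T p))).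
    rewrite /angleN !nE//; apply: flat_angle_eq; rewrite ?rkN// => c /andP[c0 _].
    by split=> h; apply: proj_ge_sym h; rewrite // !mxrank_orth !rT.
  apply/flat_angle_le; rewrite ?rkN//.
    by rewrite sqrtr_ge0/= -[leRHS]sqrtr1 ler_wsqrtr.
  move=> u uN; have [->|un] := eqVneq u 0; first by rewrite enorm0 mulr0 enorm_ge0.
  have [m mN [m1 ->]] := unitN _ un uN.
  rewrite projZ !enormZ m1 mulr1 mulrC ler_wpM2l//.
  rewrite -ler_sqr ?nnegrE ?sqrtr_ge0 ?enorm_ge0// sqr_sqrtr; last exact: le_trans e1.
  by have [] := bound m mN m1.
have le2 := eta_normal_le_eta2 r0 r41 rN0 hN.
split=> //; first by rewrite -NT (le_trans le_eta).
have TN : tangent_flat S p q <-> rN = 0.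
  rewrite tE// aflatE; split=> [qT|/eqP].
    by rewrite /rN tE// dist_set_aflat projC proj_id// subrr enorm0 mul0r.
  rewrite mulf_eq0 invr_eq0 (gt_eqF L0) orbF tE// dist_set_aflat enorm_eq0.
  by rewrite projC subr_eq0 => /eqP ->; exact: proj_sub.
by split=> // /TN ->; exact: eta_normal0.
Qed.

(** * Expansion of eta2 *)

Section Expansion.
Context (R : realType).
Implicit Types r x : R.

Definition eta2_series x : R :=
  x + 5 / 12 * x ^+ 3 + 57 / 160 * x ^+ 5 + 327 / 896 * x ^+ 7.

Definition eta2_series_deriv x : R :=
  1 + 5 / 4 * x ^+ 2 + 57 / 32 * x ^+ 4 + 327 / 128 * x ^+ 6.

(* The derivative of eta2 at x, where r = sqrt (1 - x^2) *)
Definition eta2_deriv r : R :=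
  (1 + r ^+ 2) / (2 * r ^+ 2 * Num.sqrt (r ^+ 2 + r - 1)).

(* The quotient by (1 - r)^4 in expansion_factor; mixed numbers keep the
   numerals, which are unary, small. *)
Definition expansion_cofactor r : R :=
  1 + 4 * r + 12 * r ^+ 2 + 28 * r ^+ 3 + (229 + 2041 / 4096) * r ^+ 4
    + (620 + 2027 / 4096) * r ^+ 5 + (374 + 543 / 4096) * r ^+ 6
    - (679 + 89 / 1024) * r ^+ 7 - (930 + 2037 / 2048) * r ^+ 8
    + (106 + 553 / 2048) * r ^+ 9 + (722 + 1841 / 2048) * r ^+ 10
    + (286 + 455 / 1024) * r ^+ 11 - (146 + 1375 / 4096) * r ^+ 12
    - (130 + 2165 / 4096) * r ^+ 13 - (26 + 433 / 4096) * r ^+ 14.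

(* eta2'^2 minus the square of the derivative of the series vanishes to order 4
   at r = 1, that is, to order 8 at x = 0. *)
Lemma expansion_factor r x : r ^+ 2 = 1 - x ^+ 2 ->
  (1 + r ^+ 2) ^+ 2 - 4 * r ^+ 4 * (r ^+ 2 + r - 1) * eta2_series_deriv x ^+ 2 =
  (1 - r) ^+ 4 * expansion_cofactor r.
Proof.
move=> h; have x2 : x ^+ 2 = 1 - r ^+ 2 by rewrite h; ring.
have -> : eta2_series_deriv x = 1 + 5 / 4 * (1 - r ^+ 2)
    + 57 / 32 * (1 - r ^+ 2) ^+ 2 + 327 / 128 * (1 - r ^+ 2) ^+ 3.
  by rewrite /eta2_series_deriv -x2; ring.
by rewrite /expansion_cofactor; field.
Qed.

(** 4298 is the sum of the absolute values of the coefficients, rounded up. *)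
Lemma expansion_cofactor_bound r : 0 <= r <= 1 -> `|expansion_cofactor r| <= 4298.
Proof.
move=> /andP[r0 r1]; have p n : 0 <= r ^+ n <= 1.
  by rewrite exprn_ge0//= exprn_ile1.
have p1 : 0 <= r <= 1 by rewrite r0.
move: p1 (p 2) (p 3) (p 4) (p 5) (p 6) (p 7) (p 8) (p 9) (p 10) (p 11) (p 12)
  (p 13) (p 14).
rewrite /expansion_cofactor ler_norml.
move: (r ^+ 2) (r ^+ 3) (r ^+ 4) (r ^+ 5) (r ^+ 6) (r ^+ 7) (r ^+ 8) (r ^+ 9)
  (r ^+ 10) (r ^+ 11) (r ^+ 12) (r ^+ 13) (r ^+ 14) => *.
by apply/andP; split; lra.
Qed.

(** |x| <= 1/2 keeps the radicand of [eta2_deriv] away from 0. *)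
Lemma small_radius x : x ^+ 2 <= 1 / 4 ->
  let r := Num.sqrt (1 - x ^+ 2) in
  [/\ r ^+ 2 = 1 - x ^+ 2, 17 / 20 <= r, r <= 1 & 1 / 2 <= r ^+ 2 + r - 1].
Proof.
move=> hx r; have x2 : 0 <= x ^+ 2 by exact: sqr_ge0.
have r0 : 0 <= r by exact: sqrtr_ge0.
have rE : r ^+ 2 = 1 - x ^+ 2 by rewrite sqr_sqrtr//; lra.
have r1 : 17 / 20 <= r.
  by rewrite -ler_sqr ?nnegrE//; lra.
split=> //; last lra.
by rewrite -ler_sqr ?nnegrE// rE; lra.
Qed.

Lemma asin_argument x : x ^+ 2 <= 1 / 4 ->
  let r := Num.sqrt (1 - x ^+ 2) in
  1 - (x / Num.sqrt r) ^+ 2 = (r ^+ 2 + r - 1) / r /\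
  -1 < x / Num.sqrt r < 1.
Proof.
move=> hx r; have [rE r1 r2 r3] := small_radius hx.
rewrite -/r in rE r1 r2 r3.
have r0 : 0 < r by lra.
have E : 1 - (x / Num.sqrt r) ^+ 2 = (r ^+ 2 + r - 1) / r.
  rewrite expr_div_n sqr_sqrtr ?(ltW r0)// (_ : x ^+ 2 = 1 - r ^+ 2).
    by field; rewrite lt0r_neq0.
  by rewrite rE; ring.
split=> //; rewrite -ltr_norml -(@expr_lt1 _ 2)// real_normK ?num_real//.
rewrite -subr_gt0 E divr_gt0//; lra.
Qed.

(** [acos] is not differentiable at 1, its argument in [eta2 0]; the arcsine form has argument 0
    there. *)
Lemma is_derive_asin_form x : x ^+ 2 <= 1 / 4 ->
  is_derive x 1 (fun y : R => asin (y / Num.sqrt (Num.sqrt (1 - y ^+ 2))))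
    (eta2_deriv (Num.sqrt (1 - x ^+ 2))).
Proof.
move=> hx; have [rE r1 r2 r3] := small_radius hx.
have [uE u1] := asin_argument hx.
have d1 : is_derive x 1 (fun y : R => 1 - y ^+ 2) (- (2 * x)).
  have D := is_deriveB (is_derive_cst (1 : R) x 1) (is_deriveX 2 (is_derive_id x (1 : R))).
  apply: (is_derive_eq D); rewrite sub0r /= expr1 /GRing.scale /= mulr1.
  by [].
have x1 : 0 < 1 - x ^+ 2 by lra.
have d2 : is_derive x 1 (fun y : R => Num.sqrt (1 - y ^+ 2))
    ((2 * Num.sqrt (1 - x ^+ 2))^-1 * - (2 * x)).
  exact: (@is_derive1_comp R Num.sqrt (fun y => 1 - y ^+ 2) x _ _ (is_derive1_sqrt x1) d1).
set r := Num.sqrt (1 - x ^+ 2) in rE r1 r2 r3 uE u1 d2 *.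
have r0 : 0 < r by lra.
have d3 : is_derive x 1 (fun y : R => Num.sqrt (Num.sqrt (1 - y ^+ 2)))
    ((2 * Num.sqrt r)^-1 * ((2 * r)^-1 * - (2 * x))).
  exact: (@is_derive1_comp R Num.sqrt (fun y => Num.sqrt (1 - y ^+ 2)) x _ _ (is_derive1_sqrt r0) d2).
have w0 : 0 < Num.sqrt r by rewrite sqrtr_gt0.
have d4 := is_deriveV (lt0r_neq0 w0 : (fun y : R => Num.sqrt (Num.sqrt (1 - y ^+ 2))) x != 0) d3.
have d5 := is_deriveM (is_derive_id x (1 : R)) d4.
have d6 := @is_derive1_comp R asin _ x _ _ (is_derive1_asin u1) d5.
apply: (is_derive_eq d6).
rewrite uE /GRing.scale /= -/r.
have S0 : 0 < r ^+ 2 + r - 1 by lra.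
rewrite sqrtrM ?(ltW S0)// sqrtrV ?(ltW r0)// /eta2_deriv.
have wr : Num.sqrt r ^+ 2 = r by rewrite sqr_sqrtr ?(ltW r0).
have Sq : 0 < Num.sqrt (r ^+ 2 + r - 1) by rewrite sqrtr_gt0.
have xr : x ^+ 2 = 1 - r ^+ 2 by rewrite rE; ring.
move: wr w0 Sq; move: (Num.sqrt (r ^+ 2 + r - 1)) (Num.sqrt r) => T w wr w0 T0.
have wn := lt0r_neq0 w0; have Tn := lt0r_neq0 T0.
rewrite -wr; have -> : 1 + (w ^+ 2) ^+ 2 = x ^+ 2 + 2 * (w ^+ 2) ^+ 2.
  by rewrite xr wr; ring.
by field; rewrite wn Tn.
Qed.

(** [eta2] is even and the arcsine form odd, so they are compared for x >= 0, which matches the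
    one-sided limit in the expansion. *)
Lemma eta2_asin x : 0 <= x -> x ^+ 2 <= 1 / 4 ->
  eta2 x = asin (x / Num.sqrt (Num.sqrt (1 - x ^+ 2))).
Proof.
move=> x0 hx; have [rE r1 r2 r3] := small_radius hx.
have [uE u1] := asin_argument hx; set r := Num.sqrt (1 - x ^+ 2) in rE r1 r2 r3 uE u1 *.
have r0 : 0 < r by lra.
set u := x / Num.sqrt r in uE u1 *; have [u_lo u_hi] := andP u1.
have u11 : -1 <= u <= 1 by rewrite !ltW.
have u0 : 0 <= u by rewrite divr_ge0// sqrtr_ge0.
rewrite /eta2 -/r; have <- : cos (asin u) = Num.sqrt (1 - x ^+ 2 / r).
  rewrite cos_asin// /u expr_div_n sqr_sqrtr ?(ltW r0)//.
have [lo hi] := andP (asin_def u11).1; have pp := pi_gt0 R.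
rewrite cosK// in_itv /=; apply/andP; split; last by lra.
rewrite leNgt; apply/negP => neg.
have : 0 < sin (- asin u) by apply: sin_gt0_pi; apply/andP; split; lra.
by rewrite sinN (asin_def u11).2 oppr_gt0 ltNge u0.
Qed.

(** D - P is D^2 - P^2 divided by D + P >= 1, and [expansion_factor] evaluates D^2 - P^2 without the
    root. *)
Lemma eta2_deriv_bound K x :
    (forall r, 0 <= r <= 1 -> `|expansion_cofactor r| <= K) -> x ^+ 2 <= 1 / 4 ->
  `|eta2_deriv (Num.sqrt (1 - x ^+ 2)) - eta2_series_deriv x| <= K * x ^+ 8.
Proof.
move=> cofK hx; have [rE r1 r2 r3] := small_radius hx.
set r := Num.sqrt (1 - x ^+ 2) in rE r1 r2 r3 *.
have r0 : 0 < r by lra.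
have x2 : 0 <= x ^+ 2 by exact: sqr_ge0.
have S0 : 0 < r ^+ 2 + r - 1 by lra.
have r01 : 0 <= r <= 1 by rewrite (ltW r0).
set D := eta2_deriv r; set P := eta2_series_deriv x.
have D0 : 0 <= D.
  by rewrite divr_ge0 ?addr_ge0 ?mulr_ge0 ?sqr_ge0 ?sqrtr_ge0.
have P1 : 1 <= P.
  have x4 : 0 <= x ^+ 4 by exact: exprn_even_ge0.
  have x6 : 0 <= x ^+ 6 by exact: exprn_even_ge0.
  by rewrite /P /eta2_series_deriv; lra.
pose den := 4 * r ^+ 4 * (r ^+ 2 + r - 1).
have rsq : 7 / 10 <= r ^+ 2 by rewrite rE; lra.
have den8 : 1 / 2 <= den.
  have r4 : 49 / 100 <= r ^+ 4.
    by clear -rsq; nra.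
  clear -r4 r3; rewrite /den; nra.
have den0 : 0 < den by lra.
have D2 : den * D ^+ 2 = (1 + r ^+ 2) ^+ 2.
  have Sq := sqr_sqrtr (ltW S0).
  have Sq0 : 0 < Num.sqrt (r ^+ 2 + r - 1) by rewrite sqrtr_gt0.
  rewrite /D /eta2_deriv /den -{1}Sq; move: (Num.sqrt _) Sq0 => T T0.
  by field; rewrite !lt0r_neq0.
have key : den * (D ^+ 2 - P ^+ 2) = (1 - r) ^+ 4 * expansion_cofactor r.
  by rewrite mulrBr D2 -(expansion_factor rE).
(* 1 - r = x^2 / (1 + r) with 1 + r >= 37/20, and 2 (20/37)^4 <= 1. *)
have r1x : (1 - r) ^+ 4 * 2 <= x ^+ 8.
  have h : 2 * (1 - r) <= 2 * x ^+ 2 * (20 / 37).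
    rewrite (_ : x ^+ 2 = (1 - r) * (1 + r)); first by nra.
    by rewrite (_ : (1 - r) * (1 + r) = 1 - r ^+ 2); [rewrite rE; ring|ring].
  have r1_0 : 0 <= 1 - r by lra.
  have h2 : (1 - r) ^+ 2 <= (x ^+ 2 * (20 / 37)) ^+ 2.
    by rewrite ler_sqr ?nnegrE//; [lra|rewrite mulr_ge0].
  have h4 : ((1 - r) ^+ 2) ^+ 2 <= ((x ^+ 2 * (20 / 37)) ^+ 2) ^+ 2.
    by rewrite ler_sqr ?nnegrE// sqr_ge0.
  have x8 : 0 <= x ^+ 8 by exact: exprn_even_ge0.
  rewrite -!exprM in h4; rewrite exprMn -exprM in h4.
  by move: h4; rewrite (_ : (20 / 37 : R) ^+ (2 * 2) = 20 / 37 * (20 / 37) * (20 / 37) * (20 / 37)); [lra|ring].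
have bd := cofK _ r01.
have K0 : 0 <= K by exact: le_trans bd.
have h1 : den * `|D ^+ 2 - P ^+ 2| <= den * (K * x ^+ 8).
  rewrite -{1}(gtr0_norm den0) -normrM key normrM.
  have p4 : 0 <= (1 - r) ^+ 4 by exact: exprn_even_ge0.
  rewrite (ger0_norm p4); apply: (@le_trans _ _ ((1 - r) ^+ 4 * K)).
    exact: ler_wpM2l.
  have x8 : 0 <= x ^+ 8 by exact: exprn_even_ge0.
  have : 1 / 2 * (K * x ^+ 8) <= den * (K * x ^+ 8).
    by apply: ler_wpM2r => //; exact: mulr_ge0.
  have : (1 - r) ^+ 4 * 2 * K <= x ^+ 8 * K by exact: ler_wpM2r.
  clear; lra.
rewrite ler_pM2l// in h1; apply: le_trans h1.
rewrite (_ : D ^+ 2 - P ^+ 2 = (D - P) * (D + P)); last by ring.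
rewrite normrM ler_peMr// ger0_norm; lra.
Qed.

Lemma eta2_expansion :
  (fun x : R^o => eta2 (x : R) - (x + 5 / 12 * x ^+ 3 + 57 / 160 * x ^+ 5
                                 + 327 / 896 * x ^+ 7) : R^o)
    =O_ ((0 : R)^'+) (fun x : R^o => x ^+ 9 : R^o).
Proof.
have := expansion_cofactor_bound; have : 0 < (4298 : R) by rewrite ltr0n.
(* Generalising the constant keeps its large numeral out of the computations. *)
move: (4298 : R) => K K0 cofK.
apply/eqO_exP; exists K => //; near=> x.
have x0 : 0 < x by near: x; exact: nbhs_right_gt.
have x12 : x < 1 / 2 by near: x; apply: nbhs_right_lt.
have small y : 0 <= y <= x -> y ^+ 2 <= 1 / 4.
  by move=> /andP[y0 yx]; nra.
pose h (y : R) : R := asin (y / Num.sqrt (Num.sqrt (1 - y ^+ 2))) - eta2_series y.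
have dh y : 0 <= y <= x -> is_derive y 1 h
    (eta2_deriv (Num.sqrt (1 - y ^+ 2)) - eta2_series_deriv y).
  move=> yx; apply: is_deriveB; first exact/is_derive_asin_form/small.
  pose m (c : R) n := is_deriveZ c (is_deriveX n (is_derive_id y (1 : R))).
  have D := is_deriveD (is_deriveD (is_deriveD (is_derive_id y (1 : R))
    (m (5 / 12) 3)) (m (57 / 160) 5)) (m (327 / 896) 7).
  apply: (is_derive_eq D).
  by rewrite /GRing.scale /= /eta2_series_deriv; field.
(* The bound K y^8 on the derivative at some y < x yields K x^8 times x. *)
have [||y] := @MVT R h (fun y => eta2_deriv (Num.sqrt (1 - y ^+ 2)) - eta2_series_deriv y) 0 x x0.
- by move=> y; rewrite in_itv /= => /andP[y0 yx]; apply: dh; rewrite !ltW.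
- apply: continuous_in_subspaceT => y; rewrite inE /= in_itv /= => /dh[ex _].
  by apply: differentiable_continuous; exact/derivable1_diffP.
rewrite in_itv /= subr0 => /andP[y0 yx] E.
have h0 : h 0 = 0.
  rewrite /h /eta2_series mul0r !expr0n /= !mulr0 !addr0 subr0.
  by rewrite -[X in asin X]sin0 sinK// in_itv /=; have := pi_ge0 R; lra.
have hE : eta2 x - eta2_series x = (eta2_deriv (Num.sqrt (1 - y ^+ 2)) - eta2_series_deriv y) * x.
  rewrite eta2_asin ?(ltW x0)//; last by apply: small; rewrite lexx ltW.
  by rewrite -E h0 subr0.
rewrite -/(eta2_series x) hE normrM [`|x ^+ 9|]ger0_norm ?exprn_ge0 ?(ltW x0)//.
rewrite (gtr0_norm x0) (_ : K * x ^+ 9 = K * x ^+ 8 * x); last by ring.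
rewrite ler_pM2r//; apply: le_trans (eta2_deriv_bound cofK (small _ _)) _.
  by rewrite !ltW.
by rewrite ler_pM2l// lerXn2r ?nnegrE ?(ltW y0) ?(ltW x0)// ltW.
Unshelve. all: by end_near. Qed.

End Expansion.

Theorem lemma6 (R : realType) :
  (forall (d k : nat) (S : set 'rV[R]_d) (p q : 'rV[R]_d),
     (1 <= k)%N -> (k < d)%N ->
     compact S -> smooth_submanifold k S ->
     S p -> S q ->
     let delta := dist p q / lfs S p in
     let deltaN := dist_set q (tangent_flat S p) / lfs S p in
     let angleN := flat_angle (normal_flat S p) (normal_flat S q) in
     let angleT := flat_angle (tangent_flat S p) (tangent_flat S q) in
     delta < Num.sqrt ((Num.sqrt 5 - 1) / 2) ->
     [/\ angleN = angleT,
         angleT <= eta2 delta,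
         angleN <= eta_normal delta deltaN,
         eta_normal delta deltaN <= eta2 delta &
         (tangent_flat S p q <-> deltaN = 0) /\
         (tangent_flat S p q -> eta_normal delta deltaN = eta1 delta)])
  /\
  (fun x : R^o => eta2 (x : R) - (x + 5 / 12 * x ^+ 3 + 57 / 160 * x ^+ 5
                                 + 327 / 896 * x ^+ 7) : R^o)
    =O_ ((0 : R)^'+) (fun x : R^o => x ^+ 9 : R^o).
Proof.
split; last exact: eta2_expansion.
by move=> d k S p q; exact: lemma6_bounds.
Qed.
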